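(* Let $k\in\{\mathbb{R},\mathbb{C}\}$ be fixed. The category $\mathsf{COM}$ of complete Hausdorff locally convex spaces over $k$, furnished with linear and continuous maps as morphisms, is right quasi-abelian but neither left semi-abelian nor right integral.
   Context: An additive category is pre-abelian if every morphism has a kernel and a cokernel. A morphism is called ''a kernel'' (resp. ''a cokernel'') if it is the kernel (resp. cokernel) of some morphism. A pre-abelian category is left semi-abelian if every morphism $f$ can be written as $f=i\circ p$ with $i$ a monomorphism and $p$ a cokernel. A class $\mathcal{X}$ of morphisms is stable under pullback if in any pullback square with $a\colon A\to B$, $b\colon A\to C$, $c\colon B\to D$, $d\colon C\to D$ and $c\circ a=d\circ b$, one has $a\in\mathcal{X}$ whenever $d\in\mathcal{X}$; stability under pushout is defined dually. A pre-abelian category is right quasi-abelian if kernels are stable under pushout, and right integral if monomorphisms are stable under pushout. *)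

(* Defs.v *)
From HB Require Import structures.
From mathcomp Require Import all_boot all_order all_algebra.
From mathcomp Require Import boolp classical_sets functions reals topology.
From mathcomp Require Import normedtype.
From mathcomp Require Export complex.

Set Implicit Arguments.
Unset Strict Implicit.
Unset Printing Implicit Defensive.

Import GRing.Theory Num.Theory.
Local Open Scope classical_set_scope.
Local Open Scope ring_scope.

Record preadditive := Preadditive {
  obj :> Type;
  hom : obj -> obj -> zmodType;
  idm : forall A, hom A A;
  compm : forall A B C, hom B C -> hom A B -> hom A C;
  comp_idl : forall A B (f : hom A B), compm (idm B) f = f;
  comp_idr : forall A B (f : hom A B), compm f (idm A) = f;
  comp_assoc : forall A B C D (h : hom C D) (g : hom B C) (f : hom A B),
    compm h (compm g f) = compm (compm h g) f;
  comp_addl : forall A B C (g g' : hom B C) (f : hom A B),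
    compm (g + g') f = compm g f + compm g' f;
  comp_addr : forall A B C (g : hom B C) (f f' : hom A B),
    compm g (f + f') = compm g f + compm g f'
}.

Arguments idm {p} A.

Declare Scope cat_scope.
Delimit Scope cat_scope with cat.
Notation "g \oc f" := (compm g f)
  (at level 40, left associativity, format "g  \oc  f") : cat_scope.
Local Open Scope cat_scope.

Section Categories.
Variable C : preadditive.

Definition is_zero_object (Z : C) : Prop :=
  forall X : C, (exists! f : hom Z X, True) /\ (exists! f : hom X Z, True).

Definition is_biproduct (A B P : C) (i1 : hom A P) (i2 : hom B P)
    (p1 : hom P A) (p2 : hom P B) : Prop :=
  [/\ p1 \oc i1 = idm A, p2 \oc i2 = idm B, p1 \oc i2 = 0, p2 \oc i1 = 0
    & i1 \oc p1 + i2 \oc p2 = idm P].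

Definition additive : Prop :=
  (exists Z : C, is_zero_object Z) /\
  (forall A B : C, exists (P : C) (i1 : hom A P) (i2 : hom B P)
     (p1 : hom P A) (p2 : hom P B), is_biproduct i1 i2 p1 p2).

Definition is_mono (A B : C) (f : hom A B) : Prop :=
  forall (X : C) (g h : hom X A), f \oc g = f \oc h -> g = h.

Definition is_kernel_of (K A B : C) (k : hom K A) (f : hom A B) : Prop :=
  f \oc k = 0 /\
  forall (X : C) (g : hom X A), f \oc g = 0 -> exists! h : hom X K, k \oc h = g.

Definition is_cokernel_of (A B Q : C) (q : hom B Q) (f : hom A B) : Prop :=
  q \oc f = 0 /\
  forall (X : C) (g : hom B X), g \oc f = 0 -> exists! h : hom Q X, h \oc q = g.

Definition is_a_kernel (K A : C) (k : hom K A) : Prop :=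
  exists (B : C) (f : hom A B), is_kernel_of k f.

Definition is_a_cokernel (B Q : C) (q : hom B Q) : Prop :=
  exists (A : C) (f : hom A B), is_cokernel_of q f.

Definition pre_abelian : Prop :=
  additive /\
  forall (A B : C) (f : hom A B),
    (exists (K : C) (k : hom K A), is_kernel_of k f) /\
    (exists (Q : C) (q : hom B Q), is_cokernel_of q f).

(* The square with [d : D -> C'], [c : D -> B], [a : B -> A], [b : C' -> A]. *)
Definition is_pushout (A B C' D : C) (a : hom B A) (b : hom C' A)
    (c : hom D B) (d : hom D C') : Prop :=
  a \oc c = b \oc d /\
  forall (X : C) (u : hom B X) (v : hom C' X), u \oc c = v \oc d ->
    exists! w : hom A X, w \oc a = u /\ w \oc b = v.

Definition stable_under_pushout (P : forall A B : C, hom A B -> Prop) : Prop :=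
  forall (A B C' D : C) (a : hom B A) (b : hom C' A) (c : hom D B)
    (d : hom D C'), is_pushout a b c d -> P D C' d -> P B A a.

Definition left_semi_abelian : Prop :=
  pre_abelian /\
  forall (A B : C) (f : hom A B),
    exists (I : C) (p : hom A I) (i : hom I B),
      [/\ f = i \oc p, is_mono i & is_a_cokernel p].

Definition right_quasi_abelian : Prop :=
  pre_abelian /\ stable_under_pushout is_a_kernel.

Definition right_integral : Prop :=
  pre_abelian /\ stable_under_pushout is_mono.

End Categories.

Section ContinuousLinear.
Variables (k : numFieldType) (E F : tvsType k).

Definition is_continuous_linear : {pred E -> F} :=
  fun f => `[< linear f /\ continuous f >].

Lemma is_continuous_linear_closed : zmod_closed is_continuous_linear.
Proof.
split.
  apply/asboolP; split; last by move=> x; exact: cvg_cst.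
  by move=> a u v /=; rewrite /GRing.zero /= scaler0 addr0.
move=> f g /asboolP[lf cf] /asboolP[lg cg]; apply/asboolP; split.
  move=> a u v; rewrite !fctE lf lg scalerBr.
  by rewrite opprD addrACA.
move=> x; apply: (@continuous_comp _ _ _ (fun y => (f y, g y))
  (fun z : F * F => z.1 - z.2)); first by apply: cvg_pair; [exact: cf|exact: cg].
exact: sub_continuous.
Qed.

HB.instance Definition _ := GRing.isZmodClosed.Build (E -> F)
  is_continuous_linear is_continuous_linear_closed.

Record clin := Clin {
  clin_val :> E -> F;
  clin_valP : clin_val \in is_continuous_linear
}.

HB.instance Definition _ := [isSub for clin_val].
HB.instance Definition _ := [Choice of clin by <:].
HB.instance Definition _ := [SubChoice_isSubZmodule of clin by <:].

End ContinuousLinear.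

Section ClinComposition.
Variable k : numFieldType.
Implicit Types E F G : tvsType k.

Lemma clin_idP E : (idfun : E -> E) \in @is_continuous_linear k E E.
Proof. by apply/asboolP; split => // x; exact: cvg_id. Qed.

Lemma clin_compP E F G (g : clin F G) (f : clin E F) :
  (g \o f) \in @is_continuous_linear k E G.
Proof.
have /asboolP[lg cg] := clin_valP g; have /asboolP[lf cf] := clin_valP f.
apply/asboolP; split; first by move=> a u v /=; rewrite lf lg.
by move=> x; apply: continuous_comp; [exact: cf|exact: cg].
Qed.

Definition clin_id E : clin E E := Clin (clin_idP E).
Definition clin_comp E F G (g : clin F G) (f : clin E F) : clin E G :=
  Clin (clin_compP g f).

End ClinComposition.

(* A [tvsType] carries a uniform structure that induces its topology but need
   not be related to its addition. Uniform continuity of the subtraction forces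
   it to be the canonical one, generated by the sets [(x, y) | x - y \in U] with
   [U] a neighbourhood of [0], so that completeness is that of the topological
   vector space. *)
Record complete_lcs (k : numFieldType) := CompleteLcs {
  lcs_tvs :> tvsType k;
  lcs_sub_unif_continuous :
    unif_continuous (fun x : lcs_tvs * lcs_tvs => x.1 - x.2);
  lcs_hausdorff : hausdorff_space lcs_tvs;
  lcs_complete : forall F : set_system lcs_tvs,
    ProperFilter F -> cauchy F -> exists x : lcs_tvs, F --> x
}.

Section COM.
Variable k : numFieldType.
Implicit Types E F G H : complete_lcs k.

Definition com_hom E F : zmodType := clin E F.

Lemma com_comp_idl E F (f : com_hom E F) : clin_comp (clin_id F) f = f.
Proof. exact: val_inj. Qed.

Lemma com_comp_idr E F (f : com_hom E F) : clin_comp f (clin_id E) = f.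
Proof. exact: val_inj. Qed.

Lemma com_comp_assoc E F G H (h : com_hom G H) (g : com_hom F G)
  (f : com_hom E F) :
  clin_comp h (clin_comp g f) = clin_comp (clin_comp h g) f.
Proof. exact: val_inj. Qed.

Lemma com_comp_addl E F G (g g' : com_hom F G) (f : com_hom E F) :
  clin_comp (g + g') f = clin_comp g f + clin_comp g' f :> com_hom E G.
Proof. exact: val_inj. Qed.

Lemma com_comp_addr E F G (g : com_hom F G) (f f' : com_hom E F) :
  clin_comp g (f + f') = clin_comp g f + clin_comp g f' :> com_hom E G.
Proof.
apply: val_inj; apply/funext => x /=; have /asboolP[lg _] := clin_valP g.
by have := lg 1 (f x) (f' x); rewrite !scale1r.
Qed.

Definition COM : preadditive :=
  @Preadditive (complete_lcs k) com_hom (fun E => clin_id E)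
    (fun E F G => @clin_comp k E F G)
    com_comp_idl com_comp_idr com_comp_assoc com_comp_addl com_comp_addr.

End COM.

(* Main.v *)
(* Everything is expressed by real-valued continuous seminorms. The cokernel of
   f : A -> B is the completion of B for the continuous seminorms vanishing on
   f A; the completion of a seminormed space V is the closure of V in a space of
   functions on its dual (Hahn-Banach). Kernels are exactly the topological
   embeddings, and a pushout of an embedding is an embedding because seminorms
   extend along it by an infimum. The pushout of an injection with dense image
   l1 -> k^N along a coordinate l1 -> k vanishes, so monomorphisms are not stable
   under pushout. Finally, l1 has a dense subspace that is the quotient of a
   complete space A, and composing A -> l1 with a map l1 -> k^N whose kernel is a
   line meeting this subspace in 0 gives a morphism that does not factor as a
   cokernel followed by a monomorphism. *)
From mathcomp Require Import all_boot all_order all_algebra.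
From mathcomp Require Import reals.
From HB Require Import structures.
From mathcomp Require Import boolp classical_sets functions topology.
From mathcomp Require Import interval_inference convex normedtype.
From mathcomp Require Import ring lra.
Require Import Defs.

Set Implicit Arguments.
Unset Strict Implicit.
Unset Printing Implicit Defensive.

Import Order.TTheory GRing.Theory Num.Theory.
Local Open Scope classical_set_scope.
Local Open Scope ring_scope.

(** The obstacle on the left side is that the quotient of a complete space by a closed subspace need
    not be complete. A cokernel is therefore a completion and can contain points that come from no
    vector, and a monomorphism following it must be injective on these points too. In the
    counterexample the image of A in l1 consists of finitely supported sequences, and the quotient
    topology on it is the l1 topology. The kernel of l1 -> k^N is spanned by (2^-n), which is not
    finitely supported: the induced map is injective on the quotient of A but not on its completion.
    All concrete spaces, from the zero object to the sequence spaces, come from one scheme, a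
    directed family of real gauges on a subspace of a vector space, so that Hausdorffness and
    completeness are the only points to verify for each. *)

(** An interface under which real and complex scalars are treated at once. [imag] is 0 over the
    reals and i over the complex numbers, so [scalarE] is the splitting into real and imaginary
    part, whose second summand vanishes over the reals. *)
Record scalars (R : realType) (k : numFieldType) := Scalars {
  emb : {rmorphism R -> k};
  re : k -> R;
  imag : k;
  emb_ge0 : forall r, 0 <= r -> 0 <= emb r;
  reD : forall a b, re (a + b) = re a + re b;
  reM : forall r a, re (emb r * a) = r * re a;
  re1 : re 1 = 1;
  reK : forall a, 0 <= a -> emb (re a) = a;
  re_le_norm : forall a, `|re a| <= re `|a|;
  imag_norm : `|imag| <= 1;
  imagP : imag = 0 \/ imag * imag = -1;
  scalarE : forall a, a = emb (re a) + imag * emb (re (- imag * a))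
}.

Lemma real_scalars (R : realType) : scalars R R.
Proof.
apply: (@Scalars R R idfun (fun x => x) 0) => //.
- by rewrite normr0.
- by left.
- by move=> a; rewrite mul0r addr0.
Qed.

Lemma complex_scalars (R : realType) : scalars R (complex R).
Proof.
apply: (@Scalars R (complex R) (real_complex R) (@complex.Re R) 'i%C).
- by move=> r r0; rewrite lecE /= eqxx.
- by move=> [a a'] [b b'].
- by move=> r [a a'] /=; rewrite mul0r subr0.
- by [].
- by move=> a a0; apply: RRe_real; exact: ger0_real.
- move=> [a b]; rewrite normc_def /= -sqrtr_sqr ler_wsqrtr//.
  by rewrite lerDl sqr_ge0.
- by rewrite normc_def /= expr0n /= add0r expr1n sqrtr1.
- by right; rewrite -expr2 sqr_i.
- move=> [a b]; apply/eqP; rewrite eq_complex /=.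
  by rewrite !(mulr0,mul0r,mul1r,oppr0,subr0,addr0,add0r,mulN1r,opprK) !eqxx.
Qed.

Section ScalarAbs.
Variables (R : realType) (k : numFieldType) (K : scalars R k).
Implicit Types (a b : k) (r : R).

(** The norm of [k] is [k]-valued; its real version makes the infima, suprema and linear arithmetic
    of [R] available. *)
Definition mag a : R := re K `|a|.

Lemma emb_mag a : emb K (mag a) = `|a|.
Proof. by rewrite reK. Qed.

Lemma re_emb r : re K (emb K r) = r.
Proof. by rewrite -[emb K r]mulr1 reM re1 mulr1. Qed.

Lemma reB a b : re K (a - b) = re K a - re K b.
Proof.
have <- : emb K (-1) * b = - b by rewrite rmorphN rmorph1 mulN1r.
by rewrite reD reM mulN1r.
Qed.

Lemma emb_le : {mono emb K : x y / x <= y}.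
Proof.
move=> x y; apply/idP/idP => h; last first.
  by rewrite -subr_ge0 -rmorphB emb_ge0// subr_ge0.
rewrite leNgt; apply/negP => /[dup] yx /ltW; rewrite -subr_ge0 => /(emb_ge0 K).
rewrite rmorphB subr_ge0 => h'; have e : emb K x = emb K y.
  by apply/eqP; rewrite eq_le h h'.
by move: yx; rewrite -(re_emb x) e re_emb ltxx.
Qed.

Lemma emb_lt : {mono emb K : x y / x < y}.
Proof. exact: leW_mono emb_le. Qed.

Lemma emb_gt0 r : (0 < emb K r) = (0 < r).
Proof. by rewrite -(rmorph0 (emb K)) emb_lt. Qed.

Lemma emb_eq0 r : (emb K r == 0) = (r == 0).
Proof. by rewrite -(rmorph0 (emb K)) (inj_eq (fmorph_inj (emb K))). Qed.

Lemma re_gt0 a : 0 < a -> 0 < re K a.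
Proof. by move=> a0; rewrite -emb_gt0 reK// ltW. Qed.

Lemma mag_ge0 a : 0 <= mag a.
Proof. by rewrite -emb_le emb_mag rmorph0. Qed.

Lemma mag_lt a (e : k) : 0 < e -> (mag a < re K e) = (`|a| < e).
Proof. by move=> e0; rewrite -emb_lt emb_mag reK// ltW. Qed.

Lemma mag_le1 a : (mag a <= 1) = (`|a| <= 1).
Proof. by rewrite -emb_le emb_mag rmorph1. Qed.

Lemma mag0 : mag 0 = 0.
Proof. by apply: (fmorph_inj (emb K)); rewrite emb_mag normr0 rmorph0. Qed.

Lemma mag1 : mag 1 = 1.
Proof. by rewrite /mag normr1 re1. Qed.

Lemma mag_eq0 a : (mag a == 0) = (a == 0).
Proof. by rewrite -emb_eq0 emb_mag normr_eq0. Qed.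

Lemma mag_gt0 a : (0 < mag a) = (a != 0).
Proof. by rewrite lt0r mag_ge0 andbT mag_eq0. Qed.

Lemma magM a b : mag (a * b) = mag a * mag b.
Proof.
by apply: (fmorph_inj (emb K)); rewrite rmorphM !emb_mag normrM.
Qed.

Lemma magD a b : mag (a + b) <= mag a + mag b.
Proof. by rewrite -emb_le rmorphD !emb_mag ler_normD. Qed.

Lemma magN a : mag (- a) = mag a.
Proof. by rewrite /mag normrN. Qed.

Lemma mag_sub a b : mag (a - b) = mag (b - a).
Proof. by rewrite -magN opprB. Qed.

Lemma magB a b c : mag (a - c) <= mag (a - b) + mag (b - c).
Proof. by rewrite (le_trans _ (magD _ _))// addrA subrK. Qed.

Lemma mag_emb r : mag (emb K r) = `|r|.
Proof.
have mag_emb_ge0 x : 0 <= x -> mag (emb K x) = x.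
  by move=> x0; rewrite /mag (ger0_norm (emb_ge0 K x0)) re_emb.
have [r0|r0] := ger0P r; first exact: mag_emb_ge0.
by rewrite -magN -rmorphN mag_emb_ge0// oppr_ge0 ltW.
Qed.

Lemma mag_sum (I : Type) (s : seq I) (F : I -> k) :
  mag (\sum_(i <- s) F i) <= \sum_(i <- s) mag (F i).
Proof.
elim: s => [|i s ih]; first by rewrite !big_nil mag0.
by rewrite !big_cons (le_trans (magD _ _))// lerD2l.
Qed.

Lemma re_le_mag a : `|re K a| <= mag a.
Proof. exact: re_le_norm. Qed.

Lemma mag_imag : mag (imag K) <= 1.
Proof. by rewrite mag_le1 imag_norm. Qed.

End ScalarAbs.

Section ScalarCompleteness.
Variables (R : realType) (k : numFieldType) (K : scalars R k).
Variables (V : Type) (F : set_system V).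
Hypothesis FF : ProperFilter F.

(** The limit is the lower limit of [g], the supremum of all [a] with [a <= g] along [F]; the Cauchy
    condition at [e / 4] confines it to within [e / 4] of [g v]. *)
Lemma real_cauchy_lim (g : V -> R) :
  (forall e, 0 < e -> exists v, F [set w | `|g w - g v| < e]) ->
  exists l, forall e, 0 < e -> F [set w | `|g w - l| < e].
Proof.
move=> cg; pose A := [set a | F [set w | a <= g w]].
have A0 : A !=set0.
  have [v Fv] := cg 1 ltr01; exists (g v - 1).
  by apply: filterS Fv => w /=; rewrite ltr_distl => /andP[/ltW].
have Abd b : F [set w | g w <= b] -> ubound A b.
  move=> Fb a Fa; have [w [/= h1 h2]] := filter_ex (filterI Fa Fb).
  exact: le_trans h1 h2.
have Asup : has_sup A.
  split=> //; have [v Fv] := cg 1 ltr01; exists (g v + 1); apply: Abd.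
  by apply: filterS Fv => w /=; rewrite ltr_distl => /andP[_ /ltW].
exists (sup A) => e e0; have [v Fv] := cg _ (divr_gt0 e0 (ltr0n _ 4)).
have h1 : g v - e / 4 <= sup A.
  apply: (ub_le_sup Asup.2); apply: filterS Fv => w /=.
  by rewrite ltr_distl => /andP[/ltW].
have h2 : sup A <= g v + e / 4.
  apply: (ge_sup A0); apply: Abd; apply: filterS Fv => w /=.
  by rewrite ltr_distl => /andP[_ /ltW].
apply: filterS Fv => w /=; rewrite !ltr_distl => /andP[h3 h4].
by apply/andP; split; lra.
Qed.

Lemma scalar_cauchy_lim (g : V -> k) :
  (forall e, 0 < e -> exists v, F [set w | mag K (g w - g v) < e]) ->
  exists l, forall e, 0 < e -> F [set w | mag K (g w - l) < e].
Proof.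
move=> cg.
have [|x hx] := @real_cauchy_lim (re K \o g).
  move=> e /cg[v Fv]; exists v; apply: filterS Fv => w /=; apply: le_lt_trans.
  by rewrite -reB re_le_mag.
have [|y hy] := @real_cauchy_lim (fun v => re K (- imag K * g v)).
  move=> e /cg[v Fv]; exists v; apply: filterS Fv => w /=; apply: le_lt_trans.
  rewrite -reB -mulrBr (le_trans (re_le_mag _ _))// magM magN ler_piMl//.
    exact: mag_ge0.
  exact: mag_imag.
exists (emb K x + imag K * emb K y) => e e0.
have e2 : 0 < e / 2 by rewrite divr_gt0.
apply: filterS (filterI (hx _ e2) (hy _ e2)) => w /= [h1 h2].
rewrite [g w](scalarE K) opprD addrACA -rmorphB -mulrBr -rmorphB.
rewrite (le_lt_trans (magD _ _ _))// magM !mag_emb.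
have : mag K (imag K) * `|re K (- imag K * g w) - y|
    <= `|re K (- imag K * g w) - y| by rewrite ler_piMl// mag_imag.
by move: h1 h2 => /=; lra.
Qed.

End ScalarCompleteness.

(** * Continuous seminorms on a topological vector space *)

Section Seminorms.
Variables (R : realType) (k : numFieldType) (K : scalars R k).

Definition seminorm (V : lmodType k) (p : V -> R) : Prop :=
  (forall x y, p (x + y) <= p x + p y) /\
  (forall a x, p (a *: x) = mag K a * p x).

Section Theory.
Variables (V : lmodType k) (p : V -> R).
Hypothesis sp : seminorm p.

Lemma sn0 : p 0 = 0.
Proof. by rewrite -(scale0r 0) sp.2 mag0 mul0r. Qed.

Lemma snN x : p (- x) = p x.
Proof. by rewrite -scaleN1r sp.2 magN mag1 mul1r. Qed.

Lemma snD x y : p (x + y) <= p x + p y.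
Proof. exact: sp.1. Qed.

Lemma sn_sub x y : p (x - y) = p (y - x).
Proof. by rewrite -snN opprB. Qed.

Lemma snB y x z : p (x - z) <= p (x - y) + p (y - z).
Proof. by rewrite (le_trans _ (snD _ _))// addrA subrK. Qed.

Lemma sn_ge0 x : 0 <= p x.
Proof.
have := snD x (- x); rewrite subrr sn0 snN.
by rewrite -mulr2n pmulrn_lge0.
Qed.

Lemma sn_le x y : p x <= p (x - y) + p y.
Proof. by have := snD (x - y) y; rewrite subrK. Qed.

Lemma snZ a x : p (a *: x) = mag K a * p x.
Proof. exact: sp.2. Qed.

End Theory.

Lemma seminormD (V : lmodType k) (p q : V -> R) :
  seminorm p -> seminorm q -> seminorm (fun x => p x + q x).
Proof.
move=> sp sq; split=> [x y|a x]; last by rewrite !snZ// mulrDr.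
by rewrite addrACA lerD// snD.
Qed.

Lemma seminorm_comp (V W : lmodType k) (f : V -> W) (q : W -> R) :
  linear f -> seminorm q -> seminorm (q \o f).
Proof.
move=> lf sq; split=> [x y|a x] /=.
  by have := lf 1 x y; rewrite !scale1r => ->; rewrite snD.
have f0 : f 0 = 0.
  by have := lf (-1) 0 0; rewrite !scaleN1r oppr0 addr0 addNr.
by have := lf a x 0; rewrite !addr0 f0 addr0 => ->; rewrite snZ.
Qed.

Definition cs (E : tvsType k) (p : E -> R) : Prop :=
  seminorm p /\ nbhs (0 : E) [set x | p x < 1].

Section ContinuousSeminorms.
Variable E : tvsType k.
Implicit Types (p q : E -> R) (U : set E).

Lemma affine_continuous (a : k) (x : E) :
  continuous (fun y : E => a *: (y - x)).
Proof.
move=> y; apply: (@continuous_comp _ _ _ (fun y => (a : k^o, y - x))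
  (fun z : k^o * E => z.1 *: z.2)); last exact: scale_continuous.
apply: (@cvg_pair _ _ _ _ (nbhs (a : k^o)) (nbhs (y - x))); first exact: cvg_cst.
apply: (@continuous_comp _ _ _ (fun y => (y, x)) (fun z : E * E => z.1 - z.2)).
  by apply: cvg_pair; [exact: cvg_id|exact: cvg_cst].
exact: sub_continuous.
Qed.

Lemma cs_ball p (x : E) (e : R) : cs p -> 0 < e ->
  nbhs x [set y | p (y - x) < e].
Proof.
move=> [sp p0] e0; have := @affine_continuous (emb K e^-1) x x.
rewrite /continuous_at subrr scaler0 => /(_ _ p0); rewrite nbhs_simpl /=.
apply: filterS => y /=; rewrite snZ// mag_emb ger0_norm ?invr_ge0 ?ltW//.
by rewrite mulrC ltr_pdivrMr// mul1r.
Qed.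

Lemma cs_le p q (C : R) : cs q -> seminorm p -> (forall x, p x <= C * q x) ->
  cs p.
Proof.
move=> cq sp pq; split=> //; pose D := Num.max 1 C.
have D0 : 0 < D by rewrite lt_max ltr01.
have D1 : 0 < D^-1 by rewrite invr_gt0.
apply: filterS (cs_ball 0 cq D1) => x /=; rewrite subr0 => h.
apply: le_lt_trans (pq x) _; apply: (@le_lt_trans _ _ (D * q x)).
  by rewrite ler_wpM2r ?(sn_ge0 cq.1)// le_max lexx orbT.
by rewrite mulrC -ltr_pdivlMr// mul1r.
Qed.

Lemma csD p q : cs p -> cs q -> cs (fun x => p x + q x).
Proof.
move=> cp cq; split; first exact: (seminormD cp.1 cq.1).
have h2 : (0 : R) < 2^-1 by rewrite invr_gt0.
apply: filterS (filterI (cs_ball 0 cp h2) (cs_ball 0 cq h2)) => x /=.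
by rewrite subr0 => -[]; lra.
Qed.

Lemma cs0 : cs (fun _ : E => 0 : R).
Proof.
split; last by apply: filterS filterT => x _ /=; exact: ltr01.
by split=> *; rewrite ?addr0 ?mulr0.
Qed.

(* [p] is the gauge of the absolutely convex neighbourhood [W] below. *)
Lemma cs_nbhs U : nbhs (0 : E) U ->
  exists2 p, cs p & forall x, p x < 1 -> U x.
Proof.
move=> U0.
have [B Bconv [Bop Bbas]] := @locally_convex k E.
have [b [Bb b0] bU] := Bbas 0 _ U0.
have cb x y (t : R) : 0 <= t -> t <= 1 -> b x -> b y ->
    b (emb K t *: x + (1 - emb K t) *: y).
  move=> t0 t1 bx by_.
  have [->|tn0] := eqVneq t 0; first by rewrite rmorph0 scale0r add0r subr0 scale1r.
  have [->|tn1] := eqVneq t 1; first by rewrite rmorph1 subrr scale0r addr0 scale1r.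
  have lt0 : 0 < emb K t by rewrite emb_gt0 lt0r tn0.
  have lt1 : emb K t < 1 by rewrite -(rmorph1 (emb K)) emb_lt lt_neqAle tn1.
  pose l : {i01 k} := Itv01 (ltW lt0) (ltW lt1).
  exact/set_mem/(Bconv b (mem_set Bb) x y l (mem_set bx) (mem_set by_)).
(* [W] is the balanced core of the convex set [b]: its gauge is homogeneous for all scalars, which
   the gauge of [b] alone need not be. *)
pose W := [set x : E | forall c, mag K c <= 1 -> b (c *: x)].
have Wconv x y (t : R) : 0 <= t -> t <= 1 -> W x -> W y ->
    W (emb K t *: x + (1 - emb K t) *: y).
  move=> t0 t1 Wx Wy c c1; rewrite scalerDr !scalerA ![c * _]mulrC -!scalerA.
  by apply: cb => //; [exact: Wx|exact: Wy].
have Wb x : W x -> b x by move=> /(_ 1); rewrite mag1 scale1r; apply.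
have Wbal x c : mag K c <= 1 -> W x -> W (c *: x).
  move=> c1 Wx d d1; rewrite scalerA; apply: Wx.
  by rewrite magM mulr_ile1 ?mag_ge0.
have W0 : nbhs (0 : E) W.
  have nb : nbhs (0 : E) b by apply: open_nbhs_nbhs; split=> //; exact: Bop.
  (* By joint continuity of scaling at (0, 0), a disc of radius [re K e] times [A2] lands in [b];
     with [r] half that radius, [r A2] lies in [W]. *)
  have := @scale_continuous k E (0, 0); rewrite /continuous_at scale0r.
  move=> /(_ b nb) [[/= A1 A2] [/= nA1 nA2] A12].
  have [/= e e0 eA] := nA1.
  pose r := re K e / 2.
  have r0 : 0 < r by rewrite divr_gt0// re_gt0.
  have := @affine_continuous (emb K r^-1) 0 0; rewrite /continuous_at subrr scaler0.
  move=> /(_ _ nA2); rewrite nbhs_simpl /=; apply: filterS => x /= A2x c c1.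
  have -> : c *: x = (c * emb K r) *: (emb K r^-1 *: (x - 0)).
    by rewrite subr0 scalerA -mulrA -rmorphM divff ?gt_eqF// rmorph1 mulr1.
  apply: (A12 (c * emb K r, _)); split=> //=; apply: eA => /=.
  rewrite sub0r normrN -(mag_lt K)// magM mag_emb gtr0_norm//.
  apply: (@le_lt_trans _ _ r); first by rewrite ler_piMl// ltW.
  by rewrite /r ltr_pdivrMr// ltr_pMr ?re_gt0// ltrDl.
pose G x := [set t : R | 0 < t /\ W (emb K t^-1 *: x)].
have Gup x s t : G x s -> s <= t -> G x t.
  move=> [s0 Ws] st; have t0 := lt_le_trans s0 st; split=> //.
  have -> : emb K t^-1 *: x = emb K (s / t) *: (emb K s^-1 *: x).
    by rewrite scalerA -rmorphM mulrAC divff ?gt_eqF// mul1r.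
  have st1 : s / t <= 1 by rewrite ler_pdivrMr// mul1r.
  by apply: Wbal => //; rewrite mag_emb ger0_norm// divr_ge0// ltW.
have Gex x : exists t, G x t.
  have := @scale_continuous k E (0, x); rewrite /continuous_at scale0r.
  move=> /(_ _ W0) [[/= A1 A2] [/= nA1 nA2] A12].
  have [/= e e0 eA] := nA1; pose r := re K e / 2.
  have r0 : 0 < r by rewrite divr_gt0// re_gt0.
  exists r^-1; split; first by rewrite invr_gt0.
  rewrite invrK; apply: (A12 (emb K r, x)); split=> /=; last first.
    exact: nbhs_singleton.
  apply: eA => /=.
  rewrite sub0r normrN -(mag_lt K)// mag_emb gtr0_norm// /r ltr_pdivrMr//.
  by rewrite ltr_pMr ?re_gt0// ltrDl.
have Glb x : lbound (G x) 0 by move=> t [/ltW].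
have Ginf x : has_inf (G x).
  by split; [have [t Gt] := Gex x; exists t|exists 0].
pose p x := inf (G x).
have ple x t : G x t -> p x <= t by move=> Gt; apply: (ge_inf (Ginf x).2).
have p_ge0 x : 0 <= p x by apply: lb_le_inf => //; exact: (Ginf x).1.
have plt x t : p x < t -> G x t.
  by move=> /(inf_lt (Ginf x).1)[s Gs /ltW]; exact: Gup.
have pZ1 a x : p (a *: x) <= mag K a * p x.
  have [->|a0] := eqVneq a 0.
    rewrite scale0r mag0 mul0r; apply/ler_addgt0Pl => e e0; rewrite addr0.
    apply: ple; split=> //; rewrite scaler0; exact: nbhs_singleton.
  have ma0 : 0 < mag K a by rewrite mag_gt0.
  rewrite -ler_pdivrMl//; apply: lb_le_inf; first exact: (Ginf x).1.
  move=> t [t0 Wt]; rewrite ler_pdivrMl//; apply: ple; split.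
    exact: mulr_gt0.
  have -> : emb K (mag K a * t)^-1 *: (a *: x) =
      (emb K (mag K a)^-1 * a) *: (emb K t^-1 *: x).
    rewrite !scalerA invfM rmorphM; congr (_ *: _).
    by rewrite -!mulrA [a * _]mulrC.
  apply: Wbal => //; rewrite magM mag_emb gtr0_norm ?invr_gt0//.
  by rewrite mulVf ?gt_eqF.
exists p; last first.
  move=> x /plt[_]; rewrite invr1 rmorph1 scale1r => /Wb bx; exact: bU.
split; last first.
  have := @affine_continuous (emb K 2) 0 0; rewrite /continuous_at subrr scaler0.
  move=> /(_ _ W0); rewrite nbhs_simpl /=; apply: filterS => x /=.
  rewrite subr0 => Wx; apply: (@le_lt_trans _ _ 2^-1); last by lra.
  by apply: ple; split; [rewrite invr_gt0|rewrite invrK].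
split=> [x y|a x].
  apply/ler_addgt0Pl => e e0.
  have e2 : 0 < e / 2 by rewrite divr_gt0.
  have [s0 Ws] : G x (p x + e / 2) by apply: plt; rewrite ltrDl.
  have [t0 Wt] : G y (p y + e / 2) by apply: plt; rewrite ltrDl.
  set s := p x + e / 2 in s0 Ws; set t := p y + e / 2 in t0 Wt.
  have -> : e + (p x + p y) = s + t by rewrite /s /t; field.
  have st0 : 0 < s + t by exact: addr_gt0.
  apply: ple; split=> //.
  have -> : emb K (s + t)^-1 *: (x + y) = emb K (s / (s + t)) *: (emb K s^-1 *: x)
      + (1 - emb K (s / (s + t))) *: (emb K t^-1 *: y).
    rewrite -(rmorph1 (emb K)) -rmorphB !scalerA -!rmorphM scalerDr.
    by congr (emb K _ *: _ + emb K _ *: _); field; rewrite ?gt_eqF.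
  apply: Wconv => //; first by rewrite divr_ge0 ?ltW.
  by rewrite ler_pdivrMr// mul1r lerDl ltW.
apply/eqP; rewrite eq_le pZ1 /=; have [->|a0] := eqVneq a 0.
  by rewrite mag0 mul0r.
rewrite -ler_pdivlMl ?mag_gt0//.
have {1}-> : x = a^-1 *: (a *: x) by rewrite scalerA mulVf// scale1r.
apply: le_trans (pZ1 _ _) _; rewrite le_eqVlt; apply/orP; left; apply/eqP.
congr (_ * _); apply: (mulIf (_ : mag K a != 0)); first by rewrite mag_eq0.
by rewrite -magM !mulVf ?mag1 ?mag_eq0.
Qed.

End ContinuousSeminorms.
End Seminorms.

(** * Complete spaces and their morphisms in terms of seminorms *)

Section Lcs.
Variables (R : realType) (k : numFieldType) (K : scalars R k).

Lemma nbhs_cs (E : tvsType k) (x : E) (U : set E) : nbhs x U ->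
  exists2 p, cs K p & forall y, p (y - x) < 1 -> U y.
Proof.
move=> Ux; have := @affine_continuous k E 1 (- x) 0.
rewrite /continuous_at sub0r opprK scale1r => /(_ _ Ux).
rewrite nbhs_simpl /= => /(cs_nbhs K)[p cp pU]; exists p => // y /pU.
by rewrite /= scale1r subrK.
Qed.

Lemma linear_at0 (V W : lmodType k) (f : V -> W) : linear f -> f 0 = 0.
Proof.
by move=> lf; have := lf (-1) 0 0; rewrite !scaleN1r oppr0 addr0 addNr.
Qed.

Lemma linear_sub (V W : lmodType k) (f : V -> W) (x y : V) :
  linear f -> f (x - y) = f x - f y.
Proof.
by move=> lf; have := lf (-1) y x; rewrite !scaleN1r ![- _ + _]addrC.
Qed.

Lemma linear_add (V W : lmodType k) (f : V -> W) (x y : V) :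
  linear f -> f (x + y) = f x + f y.
Proof. by move=> lf; have := lf 1 x y; rewrite !scale1r. Qed.

Lemma linear_scale (V W : lmodType k) (f : V -> W) a (x : V) :
  linear f -> f (a *: x) = a *: f x.
Proof. by move=> lf; have := lf a x 0; rewrite !addr0 linear_at0// addr0. Qed.

Lemma continuous_cs (E F : tvsType k) (f : E -> F) : linear f ->
  continuous f <-> forall q, cs K q -> cs K (q \o f).
Proof.
move=> lf; split=> [cf q cq|cf x U Ux].
  split; first exact: (seminorm_comp lf cq.1).
  by have := cf 0; rewrite /continuous_at linear_at0// => /(_ _ cq.2).
have [q cq qU] := nbhs_cs Ux.
rewrite nbhs_simpl /=; apply: filterS (cs_ball x (cf q cq) ltr01) => y /=.
by rewrite linear_sub// => /qU.
Qed.

Lemma clin_linear (E F : tvsType k) (f : clin E F) : linear f.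
Proof. by have /asboolP[] := clin_valP f. Qed.

Lemma clin_cs (E F : tvsType k) (f : clin E F) q : cs K q -> cs K (q \o f).
Proof.
by have /asboolP[lf cf] := clin_valP f; exact: (continuous_cs lf).1 cf q.
Qed.

Lemma clin_of (E F : tvsType k) (f : E -> F) : linear f ->
  (forall q, cs K q -> cs K (q \o f)) -> exists g : clin E F, g =1 f.
Proof.
move=> lf cf; have fP : f \in @is_continuous_linear k E F.
  by apply/asboolP; split=> //; exact/continuous_cs.
by exists (Clin fP).
Qed.

Lemma clin_eq (E F : tvsType k) (f g : clin E F) : f =1 g -> f = g.
Proof. by move=> fg; apply: val_inj; exact/funext. Qed.

Lemma lcs_separated (E : complete_lcs k) (x : E) :
  (forall p, cs K p -> p x = 0) -> x = 0.
Proof.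
move=> x0; apply: (@lcs_hausdorff k E) => A B nA nB.
have [p cp pA] := nbhs_cs nA; have [q cq qB] := nbhs_cs nB.
exists x; split; first by apply: pA; rewrite subrr (sn0 cp.1).
by apply: qB; rewrite subr0 x0.
Qed.

(** Uniform continuity of the subtraction makes the uniformity translation invariant: subtracting
    the diagonal pair [(- y, - y)] from [(x - y, 0)] gives [(x, y)], so closeness of [x - y] to 0
    already puts [(x, y)] in [A]. *)
Lemma lcs_entourage (E : complete_lcs k) (A : set (E * E)) : entourage A ->
  exists2 p, cs K p & forall x y, p (x - y) < 1 -> A (x, y).
Proof.
move=> entA; have [[/= U1 U2] [/= U1e U2e] U12] := lcs_sub_unif_continuous entA.
have [p cp pU] : exists2 p, cs K p & forall x : E, p x < 1 -> U1 (x, 0).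
  have n0 := nbhs_entourage (0 : E) (entourage_inv U1e).
  have [p cp pU] := nbhs_cs n0; exists p => // x px.
  by have /= := pU x; rewrite subr0 => /(_ px) /xsectionP.
exists p => // x y /pU U1xy.
have U2y : U2 (- y, - y) by exact: entourage_refl.
have /U12[[[a b] [a' b']] /= Aab [e1 e2 e3 e4]] : (U1 `*` U2)
  ((x - y, 0), (- y, - y)) by [].
by move: Aab; rewrite e1 e2 e3 e4 !opprK subrK add0r.
Qed.

Lemma lcs_cauchy_lim (E : complete_lcs k) (F : set_system E) : ProperFilter F ->
  (forall p, cs K p -> forall e, 0 < e -> exists x, F [set y | p (y - x) < e]) ->
  exists x, forall p, cs K p -> forall e, 0 < e -> F [set y | p (y - x) < e].
Proof.
move=> FF cF; have [|x Fx] := @lcs_complete k E F FF.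
  move=> A /lcs_entourage[p cp pA].
  have [x Fx] := cF p cp _ (divr_gt0 ltr01 (ltr0n _ 2)).
  set B := [set y | _] in Fx; exists (B, B) => // -[y z] [/= yB zB].
  apply: pA; apply: le_lt_trans (snB cp.1 x _ _) _; rewrite (sn_sub cp.1 x).
  by move: yB zB; rewrite /B /=; lra.
by exists x => p cp e e0; apply: Fx; exact: (cs_ball x cp e0).
Qed.

End Lcs.

(** * Locally convex spaces built from gauges *)

Section GaugedSpaces.
Variables (R : realType) (k : numFieldType) (K : scalars R k) (V : lmodType k).

(* A subspace of V with a directed family of functions that are seminorms on
   it; outside [dom] the gauges may be junk. *)
Record gauged := Gauged {
  dom : {pred V};
  gauges : set (V -> R);
  dom_submod : submod_closed dom;
  gauges_nonempty : gauges !=set0;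
  gaugeD : forall p x y, gauges p -> x \in dom -> y \in dom ->
    p (x + y) <= p x + p y;
  gaugeZ : forall p a x, gauges p -> x \in dom -> p (a *: x) = mag K a * p x;
  gauges_directed : forall p q, gauges p -> gauges q -> exists2 r, gauges r &
    forall x, x \in dom -> p x <= r x /\ q x <= r x
}.

HB.instance Definition _ (g : gauged) :=
  GRing.isSubmodClosed.Build k V (dom g) (dom_submod g).

Record gauged_elt (g : gauged) := GaugedElt {
  gval : V;
  gvalP : gval \in dom g
}.

Section Instances.
Variable g : gauged.
Local Notation T := (gauged_elt g).

HB.instance Definition _ := [isSub for @gval g].
HB.instance Definition _ := [Choice of T by <:].
HB.instance Definition _ := [SubChoice_isSubLmodule of T by <:].

Lemma gval_linear : linear (@gval g).
Proof. by move=> a x y; exact: (linearP (\val : T -> V)). Qed.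

Definition gsn (p : V -> R) (x : T) : R := p (gval x).
Local Arguments gsn : simpl never.

Lemma gauge_seminorm p : gauges g p -> seminorm K (gsn p).
Proof.
move=> gp; split=> [x y|a x]; rewrite /gsn /=.
  by rewrite (gaugeD gp) ?gvalP.
by rewrite (gaugeZ _ gp) ?gvalP.
Qed.

Definition gball (p : V -> R) (e : R) : set (T * T) :=
  [set xy | gsn p (xy.1 - xy.2) < e].

Definition gentourage : set_system (T * T) :=
  [set A | exists p e, [/\ gauges g p, 0 < e & gball p e `<=` A]].

Lemma gentourage_filter : Filter gentourage.
Proof.
split.
- by have [p gp] := gauges_nonempty g; exists p, 1.
- move=> A B [p [e [gp e0 pA]]] [q [f [gq f0 qB]]].
  have [r gr pqr] := gauges_directed gp gq.
  exists r, (Num.min e f); split=> //; first by rewrite lt_min e0.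
  move=> xy; rewrite /gball /= lt_min => /andP[re rf].
  have [pr qr] := pqr _ (gvalP (xy.1 - xy.2)).
  by split; [apply: pA|apply: qB]; apply: le_lt_trans; eassumption.
- move=> A B AB [p [e [gp e0 pA]]]; exists p, e; split=> //.
  exact: subset_trans AB.
Qed.

Lemma gentourage_diagonal A : gentourage A -> diagonal `<=` A.
Proof.
move=> [p [e [gp e0 pA]]] [x y] /= xy; apply: pA.
rewrite /gball /= (_ : x = y) // subrr.
by rewrite (sn0 (gauge_seminorm gp)).
Qed.

Lemma gentourage_inv A : gentourage A -> gentourage A^-1%relation.
Proof.
move=> [p [e [gp e0 pA]]]; exists p, e; split=> // -[x y] /= h; apply: pA.
by move: h; rewrite /gball /= (sn_sub (gauge_seminorm gp) x y).
Qed.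

Lemma gentourage_split A : gentourage A ->
  exists2 B, gentourage B & (B \; B)%relation `<=` A.
Proof.
move=> [p [e [gp e0 pA]]]; exists (gball p (e / 2)).
  by exists p, (e / 2); split=> //; rewrite divr_gt0.
move=> [x z] [y]; rewrite /gball /= => h1 h2; apply: pA; rewrite /gball /=.
by have /= := snB (gauge_seminorm gp) y x z; lra.
Qed.

HB.instance Definition _ := isUniform.Build T gentourage_filter
  gentourage_diagonal gentourage_inv gentourage_split.

Lemma gentourageP (A : set (T * T)) : entourage A <->
  exists p e, [/\ gauges g p, 0 < e & forall x y, gsn p (x - y) < e -> A (x, y)].
Proof.
split=> -[p [e [gp e0 pA]]]; exists p, e; split=> //.
  by move=> x y h; apply: pA.
by move=> [x y] /= /pA.
Qed.

Lemma gnbhsP (x : T) (A : set T) : nbhs x A <->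
  exists p e, [/\ gauges g p, 0 < e & forall y, gsn p (y - x) < e -> A y].
Proof.
rewrite -nbhs_entourageE; split=> [[B /gentourageP[p [e [gp e0 pB]]] BA]|].
  exists p, e; split=> // y; rewrite (sn_sub (gauge_seminorm gp) y x) => /pB.
  by move=> Bxy; apply: BA; exact/xsectionP.
move=> [p [e [gp e0 pA]]]; exists (gball p e).
  by apply/gentourageP; exists p, e.
move=> y /xsectionP; rewrite /gball /= => h; apply: pA.
by rewrite (sn_sub (gauge_seminorm gp) y x).
Qed.

Lemma gadd_continuous : continuous (fun x : T * T => x.1 + x.2).
Proof.
move=> [x y] A /gnbhsP[p [e [gp e0 pA]]]; have sp := gauge_seminorm gp.
have e2 : 0 < e / 2 by rewrite divr_gt0.
exists ([set z | gsn p (z - x) < e / 2], [set z | gsn p (z - y) < e / 2]).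
  by split; apply/gnbhsP; exists p, (e / 2).
move=> [a b] /= [ha hb]; apply: pA; rewrite /= opprD addrACA.
by have /= := snD sp (a - x) (b - y); lra.
Qed.

Lemma gscale_continuous : continuous (fun z : k^o * T => z.1 *: z.2).
Proof.
move=> [a x] A /gnbhsP[p [e [gp e0 pA]]]; have sp := gauge_seminorm gp.
(* [M] bounds [mag K b] once [b] is within 1 of [a], and [N] is a positive bound of [gsn p x]; both
   serve in b z - a x = b (z - x) + (b - a) x. *)
pose M := mag K a + 1; have M0 : 0 < M by rewrite ltr_wpDl ?mag_ge0.
pose N := gsn p x + 1; have N0 : 0 < N by rewrite ltr_wpDl// (sn_ge0 sp x).
pose d := Num.min 1 (e / 2 / N).
have d0 : 0 < d by rewrite lt_min ltr01 !divr_gt0.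
exists ([set b : k^o | `|a - b| < emb K d], [set z | gsn p (z - x) < e / 2 / M]).
  split; first by exists (emb K d) => //=; rewrite emb_gt0.
  by apply/gnbhsP; exists p, (e / 2 / M); rewrite !divr_gt0.
move=> [b z] /= [hb hz]; apply: pA.
have {hb} : mag K (a - b) < d by rewrite -(emb_lt K) emb_mag.
rewrite lt_min mag_sub => /andP[b1 bN].
have bM : mag K b <= M.
  have := magD K (b - a) a; rewrite subrK /M => /le_trans; apply.
  by rewrite addrC lerD2l ltW.
rewrite /= (_ : _ - _ = b *: (z - x) + (b - a) *: x); last first.
  by rewrite scalerBr scalerBl addrA subrK.
apply: le_lt_trans (snD sp _ _) _; rewrite !(snZ sp).
have h1 : mag K b * gsn p (z - x) <= e / 2.
  apply: (@le_trans _ _ (M * (e / 2 / M))).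
    by rewrite ler_pM ?mag_ge0 ?(sn_ge0 sp (z - x))// ltW.
  by rewrite mulrCA divff ?gt_eqF// mulr1.
have h2 : mag K (b - a) * gsn p x < e / 2.
  apply: (@le_lt_trans _ _ (mag K (b - a) * N)).
    by rewrite ler_wpM2l ?mag_ge0// lerDl.
  by rewrite -ltr_pdivlMr.
by move: h1 h2; lra.
Qed.

Lemma glocally_convex :
  exists2 B : set_system T, (forall b, b \in B -> convex_set b) & basis B.
Proof.
pose ball p x e := [set y : T | gsn p (y - x) < e].
exists [set b | exists p x e, [/\ gauges g p, 0 < e & b = ball p x e]].
  move=> b /set_mem[p [x [e [gp e0 ->]]]] y z l.
  have sp := gauge_seminorm gp.
  move=> /set_mem yb /set_mem zb; apply/mem_set; rewrite /ball /=.
  have l0 : 0 <= l%:num by [].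
  have l1 : l%:num <= 1 by [].
  have -> : (conv l (y : convex_lmodType T) z : T) - x =
      l%:num *: (y - x) + (1 - l%:num) *: (z - x).
    rewrite !scalerBr addrACA -opprD -scalerDl.
    by rewrite (_ : _ + (1 - _) = 1) ?scale1r// addrC subrK.
  (* The convexity weight lives in [k]; being nonnegative, it comes from a real number. *)
  have [m em] : exists m, l%:num = emb K m by exists (re K l%:num); rewrite reK.
  have m0 : 0 <= m by rewrite -(emb_le K) rmorph0 -em.
  have m1 : m <= 1 by rewrite -(emb_le K) rmorph1 -em.
  rewrite em; apply: le_lt_trans (snD sp _ _) _; rewrite !(snZ sp).
  rewrite -(rmorph1 (emb K)) -rmorphB !mag_emb !ger0_norm ?subr_ge0//.
  move: yb zb; rewrite /ball /=; set u := gsn _ _; set v := gsn _ _ => ue ve.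
  have [->|mn0] := eqVneq m 0; first by rewrite mul0r add0r subr0 mul1r.
  have : m * u < m * e by rewrite ltr_pM2l// lt0r mn0.
  have : (1 - m) * v <= (1 - m) * e by rewrite ler_wpM2l ?subr_ge0// ltW.
  by lra.
split.
  move=> b [p [x [e [gp e0 ->]]]]; rewrite openE => y /= ye.
  apply/gnbhsP; exists p, (e - gsn p (y - x)); split=> //.
    by rewrite subr_gt0.
  move=> z; rewrite /ball /=; have /= := snB (gauge_seminorm gp) y z x; lra.
move=> x A /gnbhsP[p [e [gp e0 pA]]]; exists (ball p x e).
  split; first by exists p, x, e.
  by rewrite /ball /= subrr (sn0 (gauge_seminorm gp)).
by move=> y /pA.
Qed.

HB.instance Definition _ :=
  PreTopologicalNmodule_isTopologicalNmodule.Build T gadd_continuous.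
HB.instance Definition _ :=
  TopologicalNmodule_isTopologicalLmodule.Build k T gscale_continuous.
HB.instance Definition _ := Uniform_isTvs.Build k T glocally_convex.

Lemma gsub_unif_continuous : unif_continuous (fun x : T * T => x.1 - x.2).
Proof.
move=> A /gentourageP[p [e [gp e0 pA]]].
have sp := gauge_seminorm gp.
have e2 : 0 < e / 2 by rewrite divr_gt0.
exists (gball p (e / 2), gball p (e / 2)).
  by split; apply/gentourageP; exists p, (e / 2).
move=> [[a b] [c d]] /= [hab hcd]; exists ((a, c), (b, d)) => //=.
apply: pA; rewrite (_ : a - c - (b - d) = a - b + (d - c)); last first.
  by rewrite opprB addrACA [RHS]addrACA [- c - b]addrC.
move: hab hcd; rewrite /gball /=.
have := snD sp (a - b) (d - c); rewrite (sn_sub sp d c); lra.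
Qed.

End Instances.

(* The Cauchy filters live on V rather than on the subspace, which spares all
   later constructions the subtype. *)
Lemma gauged_lcs (g : gauged) :
  (forall x, x \in dom g -> (forall p, gauges g p -> p x = 0) -> x = 0) ->
  (forall F : set_system V, ProperFilter F -> F [set` dom g] ->
    (forall p, gauges g p -> forall e, 0 < e ->
      exists2 x, x \in dom g & F [set y | p (y - x) < e]) ->
    exists2 x, x \in dom g &
      forall p, gauges g p -> forall e, 0 < e -> F [set y | p (y - x) < e]) ->
  exists (X : complete_lcs k) (i : X -> V),
    [/\ linear i, injective i, (forall v, v \in dom g <-> exists x, i x = v) &
        forall q, cs K q <-> seminorm K q /\ exists p C,
          [/\ gauges g p, 0 < C & forall x, q x <= C * p (i x)]].
Proof.
move=> sep compl.
have haus : hausdorff_space (gauged_elt g).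
  move=> x y xy; apply/eqP; rewrite -subr_eq0; apply/eqP/val_inj => /=.
  apply: sep; first exact: (gvalP (x - y)).
  move=> p gp; have sp := gauge_seminorm gp; apply/eqP.
  rewrite -[p _]/(gsn p (x - y)) eq_le (sn_ge0 sp); rewrite andbT; apply/ler_addgt0Pl => e e0; rewrite addr0.
  have e2 : 0 < e / 2 by rewrite divr_gt0.
  have [||z /= [zx zy]] := xy [set z | gsn p (z - x) < e / 2]
      [set z | gsn p (z - y) < e / 2].
  - by apply/gnbhsP; exists p, (e / 2).
  - by apply/gnbhsP; exists p, (e / 2).
  have /= := snB sp z x y; rewrite (sn_sub sp x z) /=; lra.
have comp : forall F : set_system (gauged_elt g), ProperFilter F -> cauchy F ->
    exists x : gauged_elt g, F --> x.
  move=> F FF cF; pose G : set_system V := [set A | F [set x | A (gval x)]].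
  have GF : ProperFilter G.
    split; first exact: filter_not_empty.
    split; first exact: filterT.
    - by move=> A B; exact: filterI.
    - by move=> A B AB; apply: filterS => x; exact: AB.
  have [|p gp e e0|x xd Gx] := compl G GF.
  - apply: (@filterS _ F _ setT); last exact: filterT.
    by move=> x _ /=; exact: (gvalP x).
  - have [|[A B] /= [FA FB] AB] := cF (gball p e).
      by apply/gentourageP; exists p, e.
    have [x Bx] := filter_ex FB; exists (gval x); first exact: (gvalP x).
    apply: filterS FA => y Ay /=; rewrite -(linear_sub _ _ (@gval_linear g)).
    by have := AB (y, x); apply.
  - exists (GaugedElt xd) => A /gnbhsP[p [e [gp e0 pA]]].
    have FG : F [set y | p (gval y - x) < e] := Gx p gp e e0.
    by apply: filterS FG => y /= h; exact: pA.
exists (CompleteLcs (@gsub_unif_continuous g) haus comp), (@gval g); split.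
- exact: gval_linear.
- by move=> x y; exact: val_inj.
- by move=> v; split=> [vd|[x <-]]; [exists (GaugedElt vd)|exact: (gvalP x)].
move=> q; split=> [[sq /gnbhsP[p [e [gp e0 pq]]]]|[sq [p [C [gp C0 pq]]]]].
  split=> //; exists p, (2 / e); split=> //; first by rewrite divr_gt0.
  have sp := gauge_seminorm gp.
  (* If the bound failed at [x], the vector x / q(x) would have gauge below [e], hence [q]-value
     below 1, while its [q]-value is 1. *)
  move=> x; rewrite leNgt; apply/negP => lt.
  have px := sn_ge0 sp x; 
  have qx0 : 0 < q x by apply: le_lt_trans lt; rewrite mulr_ge0// divr_ge0// ltW.
  have := pq (emb K (q x)^-1 *: x); rewrite subr0 /= (snZ sq) (snZ sp).
  rewrite mag_emb gtr0_norm ?invr_gt0// mulVf ?gt_eqF// ltxx.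
  suff h : (q x)^-1 * gsn p x < e by move=> /(_ h).
  rewrite -ltr_pdivlMl ?invr_gt0// invrK; move: lt.
  rewrite mulrAC ltr_pdivrMr//; rewrite -/(gsn p x); have := mulr_gt0 qx0 e0; lra.
split=> //; apply/gnbhsP; exists p, C^-1; split=> //; first by rewrite invr_gt0.
move=> x; rewrite subr0 => h /=; apply: le_lt_trans (pq x) _.
by rewrite -ltr_pdivlMl// mulr1.
Qed.

End GaugedSpaces.

(** * Function spaces gauged by suprema of finite weighted sums *)

Section FunctionSpaces.
Variables (R : realType) (k : numFieldType) (K : scalars R k) (T : Type).
Local Notation fn := (T -> k^o).
Implicit Types (l : seq (T * R)) (x y : fn) (L : set (seq (T * R))).

(** A list of weighted points gives one finite sum; a set [L] of lists stands for the gauge that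
    takes the supremum of [wsum l] over [l] in [L]. Lists of length one give sup norms, as in
    [completion]; all lists without repeated points give weighted l1 norms, as in [weighted_l1]. *)
Definition wsum l x : R := \sum_(tw <- l) tw.2 * mag K (x tw.1).

Lemma wsum_nil x : wsum [::] x = 0.
Proof. by rewrite /wsum big_nil. Qed.

Lemma wsum_cons t w l x : wsum ((t, w) :: l) x = w * mag K (x t) + wsum l x.
Proof. by rewrite /wsum big_cons. Qed.

Definition nonneg l := forall j, (j < size l)%N -> 0 <= nth 0 (unzip2 l) j.

Lemma nonneg_cons t w l : nonneg ((t, w) :: l) -> 0 <= w /\ nonneg l.
Proof. by move=> h; split=> [|j hj]; [exact: (h 0%N)|exact: (h j.+1)]. Qed.

Lemma wsum_ge0 l x : nonneg l -> 0 <= wsum l x.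
Proof.
elim: l => [|[t w] l ih] => [_|/nonneg_cons[w0 /ih h]]; first by rewrite wsum_nil.
by rewrite wsum_cons addr_ge0// mulr_ge0// mag_ge0.
Qed.

Lemma wsumD l x y : nonneg l -> wsum l (x + y) <= wsum l x + wsum l y.
Proof.
elim: l => [|[t w] l ih] => [_|/nonneg_cons[w0 /ih h]].
  by rewrite !wsum_nil addr0.
by rewrite !wsum_cons addrACA -mulrDr lerD// ler_wpM2l// magD.
Qed.

Lemma wsumZ l a x : wsum l (a *: x) = mag K a * wsum l x.
Proof.
elim: l => [|[t w] l ih]; first by rewrite !wsum_nil mulr0.
by rewrite !wsum_cons ih magM mulrDr mulrCA.
Qed.

Lemma wsum_sub l x y : wsum l (x - y) = wsum l (y - x).
Proof. by rewrite -opprB -scaleN1r wsumZ magN mag1 mul1r. Qed.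

Lemma wsumB l y x z : nonneg l ->
  wsum l (x - z) <= wsum l (x - y) + wsum l (y - z).
Proof. by move=> l0; have := wsumD (x - y) (y - z) l0; rewrite addrA subrK. Qed.

Lemma wsum_near (F : set_system fn) (x : fn) l (d : R) : ProperFilter F ->
  (forall t e, 0 < e -> F [set y | mag K (y t - x t) < e]) -> 0 < d ->
  F [set y | wsum l (y - x) < d].
Proof.
move=> FF Fx; elim: l d => [|[t w] l ih] d d0.
  by apply: filterS filterT => y _ /=; rewrite wsum_nil.
have d2 : 0 < d / 2 by rewrite divr_gt0.
have w0 : 0 < `|w| + 1 by rewrite ltr_wpDl.
have Ft := Fx t _ (divr_gt0 d2 w0).
apply: filterS (filterI Ft (ih _ d2)) => y /= [ht hl]; rewrite wsum_cons.
suff : w * mag K ((y - x) t) <= d / 2 by move: hl; lra.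
apply: (@le_trans _ _ ((`|w| + 1) * mag K (y t - x t))).
  by rewrite ler_wpM2r ?mag_ge0// (le_trans (ler_norm w))// lerDl.
by rewrite -ler_pdivlMl// mulrC ltW.
Qed.

(** The gauges control evaluations, so a Cauchy filter has a pointwise limit. Each [wsum l] involves
    finitely many points and passes to this limit, so estimates uniform in [l] survive, and the last
    hypothesis on [S], a form of closedness, puts the limit in [S]. *)
Lemma function_space (LL : set (set (seq (T * R)))) (S : set fn) :
  LL !=set0 ->
  (forall L, LL L -> L !=set0 /\ forall l, L l -> nonneg l) ->
  (forall L M, LL L -> LL M -> exists2 N, LL N &
    forall l, L l \/ M l -> exists2 l', N l' & forall x, wsum l x <= wsum l' x) ->
  (forall t, exists2 L, LL L & exists2 w, 0 < w & L [:: (t, w)]) ->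
  S 0 -> (forall a x y, S x -> S y -> S (a *: x + y)) ->
  (forall x, S x -> forall L, LL L -> exists b, forall l, L l -> wsum l x <= b) ->
  (forall x, (forall L e, LL L -> 0 < e ->
    exists2 y, S y & forall l, L l -> wsum l (x - y) <= e) -> S x) ->
  exists (X : complete_lcs k) (i : X -> fn),
    [/\ linear i, injective i, (forall x, S x <-> exists u, i u = x),
      (forall L, LL L -> exists2 r, cs K r &
        forall u l, L l -> wsum l (i u) <= r u) &
      forall q, cs K q <-> seminorm K q /\ exists L C, [/\ LL L, 0 < C &
        forall u b, (forall l, L l -> wsum l (i u) <= b) -> q u <= C * b]].
Proof.
move=> LL0 LLn LLdir LLpt S0 Slin Sbd Scl.
pose D : {pred fn} := fun x => `[< S x >].
have Dsub : submod_closed D.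
  split; first exact/asboolP.
  by move=> a x y /asboolP Sx /asboolP Sy; apply/asboolP; exact: Slin.
have SB x y : S x -> S y -> S (x - y).
  by move=> Sx Sy; rewrite -scaleN1r addrC; exact: Slin.
(* Meaningful on [S] only: elsewhere the set may be unbounded and [sup] is then a default value. *)
pose N L x := sup [set wsum l x | l in L].
have Nub L x l : LL L -> S x -> L l -> wsum l x <= N L x.
  move=> LLL Sx Ll; apply: ub_le_sup; last by exists l.
  by have [b hb] := Sbd x Sx L LLL; exists b => _ [l' Ll' <-]; exact: hb.
have Nle L x b : LL L -> (forall l, L l -> wsum l x <= b) -> N L x <= b.
  move=> LLL hb; apply: ge_sup; last by move=> _ [l Ll <-]; exact: hb.
  by have [[l Ll] _] := LLn L LLL; exists (wsum l x), l.
have N_ge0 L x : LL L -> S x -> 0 <= N L x.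
  move=> LLL Sx; have [[l Ll] nn] := LLn L LLL.
  by apply: le_trans (Nub L x l LLL Sx Ll); exact/wsum_ge0/nn.
have NZ L a x : LL L -> S x -> N L (a *: x) = mag K a * N L x.
  move=> LLL Sx; have Sax : S (a *: x) by rewrite -[_ *: _]addr0; exact: Slin.
  apply/eqP; rewrite eq_le; apply/andP; split.
    by apply: Nle => // l Ll; rewrite wsumZ ler_wpM2l ?mag_ge0//; exact: Nub.
  have [->|a0] := eqVneq a 0; first by rewrite mag0 mul0r N_ge0// scale0r.
  rewrite -ler_pdivlMl ?mag_gt0//; apply: Nle => // l Ll.
  by rewrite ler_pdivlMl ?mag_gt0// -wsumZ; exact: Nub.
have [g [gdom ggauges]] : exists g : gauged K fn,
    dom g = D /\ gauges g = [set N L | L in LL].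
  have ne : [set N L | L in LL] !=set0 by have [L LLL] := LL0; exists (N L), L.
  have gD p x y : [set N L | L in LL] p -> x \in D -> y \in D ->
      p (x + y) <= p x + p y.
    move=> [L LLL <-] /asboolP Sx /asboolP Sy; apply: Nle => // l Ll.
    rewrite (le_trans (wsumD _ _ _))//; first exact: (LLn L LLL).2.
    by rewrite lerD//; exact: Nub.
  have gZ p a x : [set N L | L in LL] p -> x \in D -> p (a *: x) = mag K a * p x.
    by move=> [L LLL <-] /asboolP Sx; exact: NZ.
  have gdir p q : [set N L | L in LL] p -> [set N L | L in LL] q ->
      exists2 r, [set N L | L in LL] r &
        forall x, x \in D -> p x <= r x /\ q x <= r x.
    move=> [L LLL <-] [M LLM <-]; have [P LLP LMP] := LLdir L M LLL LLM.
    exists (N P); first by exists P.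
    move=> x /asboolP Sx; split; apply: Nle => // l Ll.
      have [l' Pl' ll'] := LMP l (or_introl Ll).
      by rewrite (le_trans (ll' x))//; exact: Nub.
    have [l' Pl' ll'] := LMP l (or_intror Ll).
    by rewrite (le_trans (ll' x))//; exact: Nub.
  by exists (Gauged Dsub ne gD gZ gdir).
have [||X [i [li ii iS csX]]] := @gauged_lcs R k K fn g.
- move=> x; rewrite gdom ggauges => /asboolP Sx x0; apply/funext => t.
  have [L LLL [w w0 Lw]] := LLpt t.
  have := Nub L x _ LLL Sx Lw; rewrite (x0 (N L)); last by exists L.
  rewrite wsum_cons wsum_nil addr0 pmulr_rle0// => h.
  by apply/eqP; rewrite -(mag_eq0 K) eq_le h mag_ge0.
- move=> F FF; rewrite gdom ggauges => FD Fc.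
  have FS : F S by apply: filterS FD => x /asboolP.
  have Fc' L e : LL L -> 0 < e -> exists2 x, S x &
      F [set y | S y /\ forall l, L l -> wsum l (y - x) < e].
    move=> LLL e0; have [|x /asboolP Sx Fx] := Fc (N L) _ e e0; first by exists L.
    exists x => //; apply: filterS (filterI FS Fx) => y [/= Sy hy]; split=> // l Ll.
    by apply: le_lt_trans hy; apply: Nub => //; exact: SB.
  have [x0 Fx0] : exists x0 : fn, forall t e, 0 < e ->
      F [set y | mag K (y t - x0 t) < e].
    suff /choice[x0 Fx0] : forall t, exists a : k^o, forall e, 0 < e ->
      F [set y : fn | mag K (y t - a) < e] by exists x0.
    move=> t.
    apply: (@scalar_cauchy_lim R k K fn F FF (fun y => y t)) => e e0.
    have [L LLL [w w0 Lw]] := LLpt t.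
    have [x Sx Fx] := Fc' L _ LLL (mulr_gt0 w0 e0).
    exists x; apply: filterS Fx => y [Sy /(_ _ Lw)] /=.
    by rewrite wsum_cons wsum_nil addr0 ltr_pM2l.
  (* For each [l], some [z] that is both in the Cauchy set and near [x0] at the points of [l] is
     inserted between [y] and [x0]; [z] depends on [l], the resulting bound [e] does not. *)
  have key L e : LL L -> 0 < e ->
      F [set y | S y /\ forall l, L l -> wsum l (y - x0) <= e].
    move=> LLL e0; have e2 : 0 < e / 2 by rewrite divr_gt0.
    have [x Sx Fx] := Fc' L _ LLL e2.
    apply: filterS (Fx) => y /= [Sy hy]; split=> // l Ll.
    have nn := (LLn L LLL).2 l Ll.
    apply/ler_addgt0Pl => d d0.
    have [z [/= [Sz /(_ l Ll) hz] hz']] := filter_ex (filterI Fx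
      (wsum_near l FF Fx0 d0)).
    have h1 := wsumB x y x0 nn; have h2 := wsumB z x x0 nn.
    by have := hy l Ll; move: hz hz' h1 h2; rewrite (wsum_sub l x z); lra.
  have Sx0 : S x0.
    apply: Scl => L e LLL e0; have [y [Sy hy]] := filter_ex (key L e LLL e0).
    by exists y => // l Ll; rewrite wsum_sub; exact: hy.
  exists x0; first exact/asboolP.
  move=> p [L LLL <-] e e0; have e2 : 0 < e / 2 by rewrite divr_gt0.
  apply: filterS (key L _ LLL e2) => y /= [Sy hy].
  by apply: (@le_lt_trans _ _ (e / 2)); [exact: Nle|lra].
have Si u : S (i u).
  by apply/asboolP; have := (iS (i u)).2; rewrite gdom; apply; exists u.
exists X, i; split=> //.
- by move=> x; rewrite -iS gdom; split=> [Sx|/asboolP]; [exact/asboolP|].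
- move=> L LLL; exists (N L \o i); last by move=> u l Ll; exact: Nub.
  have gL : gauges g (N L) by rewrite ggauges; exists L.
  have iD u : i u \in dom g by apply/iS; exists u.
  rewrite csX; split; last by exists (N L), 1; split=> // u; rewrite mul1r.
  split=> [x y|a x] /=; first by rewrite (linear_add _ _ li) (gaugeD gL).
  by rewrite (linear_scale _ _ li) (gaugeZ _ gL).
move=> q; rewrite csX ggauges; split=> -[sq].
  move=> [p [C [[L LLL <-] C0 h]]]; split=> //; exists L, C; split=> // u b hb.
  by rewrite (le_trans (h u))// ler_wpM2l ?(ltW C0)//; exact: Nle.
move=> [L [C [LLL C0 h]]]; split=> //; exists (N L), C; split=> //.
  by exists L.
by move=> u; apply: h => l Ll; exact: Nub.
Qed.

End FunctionSpaces.

(** * The Hahn-Banach theorem for seminorms *)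

Section HahnBanach.
Variables (R : realType) (k : numFieldType) (K : scalars R k) (V : lmodType k).
Implicit Types (p q u : V -> R) (x y v : V) (t s : R).

Definition sublinear q : Prop := (forall x y, q (x + y) <= q x + q y) /\
  (forall t x, 0 <= t -> q (emb K t *: x) = t * q x).

Lemma sublinear0 q : sublinear q -> q 0 = 0.
Proof. by move=> sq; rewrite -(scaler0 _ (emb K 0)) sq.2// mul0r. Qed.

Lemma sublinear_lb q x : sublinear q -> - q (- x) <= q x.
Proof.
move=> sq; rewrite -subr_ge0 opprK; have := sq.1 x (- x).
by rewrite subrr sublinear0.
Qed.

Lemma seminorm_sublinear p : seminorm K p -> sublinear p.
Proof.
move=> sp; split; first exact: sp.1.
by move=> t x t0; rewrite (snZ sp) mag_emb ger0_norm.
Qed.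

(** The witness is q'(x) = inf over t >= 0 of q(x + t v) - t q(v): t = 0 gives q' <= q, and t = 1
    gives the bound at [- v]. It shows that a minimal functional is odd and also serves to prescribe
    a value at a vector. *)
Lemma sublinear_shift q v : sublinear q ->
  exists q', [/\ sublinear q', forall x, q' x <= q x & q' (- v) <= - q v].
Proof.
move=> sq; pose A x := [set q (x + emb K t *: v) - t * q v | t in [set t | 0 <= t]].
have Alb x : lbound (A x) (- q (- x)).
  move=> _ [t /= t0 <-]; have := sq.1 (x + emb K t *: v) (- x).
  by rewrite addrAC subrr add0r (sq.2 _ _ t0); lra.
have Ainf x : has_inf (A x).
  split; last by exists (- q (- x)).
  by exists (q (x + emb K 0 *: v) - 0 * q v), 0; rewrite /=.
pose q' x := inf (A x).
have q'le x t : 0 <= t -> q' x <= q (x + emb K t *: v) - t * q v.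
  by move=> t0; apply: (ge_inf (Ainf x).2); exists t.
have q'ge x b : (forall t, 0 <= t -> b <= q (x + emb K t *: v) - t * q v) ->
    b <= q' x.
  by move=> h; apply: lb_le_inf; [exact: (Ainf x).1|move=> _ [t t0 <-]; exact: h].
have q'Z c x : 0 < c -> q' (emb K c *: x) <= c * q' x.
  move=> c0; rewrite -ler_pdivrMl//; apply: q'ge => t t0; rewrite ler_pdivrMl//.
  have := q'le (emb K c *: x) (c * t) (mulr_ge0 (ltW c0) t0).
  by rewrite rmorphM -scalerA -scalerDr (sq.2 _ _ (ltW c0)) mulrBr mulrA.
have q'q x : q' x <= q x.
  by have := q'le x 0 (lexx _); rewrite rmorph0 scale0r addr0 mul0r subr0.
exists q'; split=> //; last first.
  have := q'le (- v) 1 ler01; rewrite rmorph1 scale1r addNr sublinear0//.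
  by rewrite mul1r sub0r.
split=> [x y|t x]; last first.
  rewrite le_eqVlt => /orP[/eqP <-|t0].
    rewrite rmorph0 scale0r mul0r; apply/eqP; rewrite eq_le.
    rewrite -[X in _ <= X](sublinear0 sq) q'q /=.
    by apply: q'ge => s s0; rewrite add0r sq.2// subrr.
  apply/eqP; rewrite eq_le q'Z//= -ler_pdivlMl//.
  have := q'Z t^-1 (emb K t *: x); rewrite scalerA -rmorphM mulVf ?gt_eqF//.
  by rewrite rmorph1 scale1r; apply; rewrite invr_gt0.
rewrite -lerBlDr; apply: (q'ge) => t t0; rewrite lerBlDr [leRHS]addrC -lerBlDr.
apply: q'ge => s s0; rewrite lerBlDr.
have := q'le (x + y) (t + s) (addr_ge0 t0 s0).
rewrite rmorphD scalerDl addrACA.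
have := sq.1 (x + emb K t *: v) (y + emb K s *: v); lra.
Qed.

(** Zorn's lemma for the reversed order. A chain is bounded by its pointwise infimum, which is
    finite because every sublinear functional below [p] is at least [- p (- x)] at [x]. *)
Lemma minimal_sublinear p : sublinear p -> exists u, [/\ sublinear u,
  forall x, u x <= p x & forall q, sublinear q -> (forall x, q x <= u x) -> q = u].
Proof.
move=> sp; pose T := {q : V -> R | sublinear q /\ forall x, q x <= p x}.
pose below : rel T := fun a b => `[< forall x, sval b x <= sval a x >].
have [||||[u [su up]] umin] := @Zorn T below.
- by move=> a; apply/asboolP.
- move=> a b c /asboolP ab /asboolP bc; apply/asboolP => x.
  exact: le_trans (bc x) (ab x).
- move=> [a aP] [b bP] /asboolP ab /asboolP ba.
  have e : a = b by apply/funext => x; apply/eqP; rewrite eq_le ab ba.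
  by apply: eq_exist.
- move=> A totA; have [[a0 Aa0]|A0] := pselect (A !=set0); last first.
    exists (exist _ p (conj sp (fun x => lexx (p x)))) => s As.
    by exfalso; apply: A0; exists s.
  pose B x := [set sval a x | a in A].
  have Blb x : lbound (B x) (- p (- x)).
    move=> _ [[a [sa ap]] Aa <-] /=; apply: le_trans (sublinear_lb x sa).
    by rewrite lerN2.
  have Binf x : has_inf (B x).
    by split; [exists (sval a0 x), a0|exists (- p (- x))].
  pose q x := inf (B x).
  have qle x a : A a -> q x <= sval a x.
    by move=> Aa; apply: (ge_inf (Binf x).2); exists a.
  have qge x b : (forall a, A a -> b <= sval a x) -> b <= q x.
    by move=> h; apply: lb_le_inf; [exact: (Binf x).1|move=> _ [a Aa <-]; exact: h].
  have qZ c x : 0 <= c -> c * q x <= q (emb K c *: x).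
    move=> c0; apply: qge => a Aa; have [sa _] := svalP a.
    by rewrite sa.2// ler_wpM2l// qle.
  have sq : sublinear q.
    split=> [x y|t x].
      rewrite -lerBlDr; apply: (qge) => a Aa; rewrite lerBlDr [leRHS]addrC -lerBlDr.
      apply: qge => b Ab; rewrite lerBlDr; have [sa _] := svalP a.
      (* In a chain the smaller of [a] and [b] can be used at both [x] and [y], which makes the
         infimum subadditive. *)
      have [sb _] := svalP b; have [/asboolP h|/asboolP h] := totA a b Aa Ab.
        have := h x; have := sb.1 x y; have := qle (x + y) b Ab; lra.
      have := h y; have := sa.1 x y; have := qle (x + y) a Aa; lra.
    rewrite le_eqVlt => /orP[/eqP <-|t0]; last first.
      apply/eqP; rewrite eq_le qZ ?(ltW t0)// andbT -ler_pdivrMl//.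
      have := qZ t^-1 (emb K t *: x); rewrite scalerA -rmorphM mulVf ?gt_eqF//.
      by rewrite rmorph1 scale1r; apply; rewrite invr_ge0 ltW.
    rewrite rmorph0 scale0r mul0r; apply/eqP; rewrite eq_le; apply/andP; split.
      by have [sa _] := svalP a0; rewrite -(sublinear0 sa); exact: qle.
    by apply: qge => a _; have [sa _] := svalP a; rewrite sublinear0.
  have qp x : q x <= p x.
    by have [_ ap] := svalP a0; exact: le_trans (qle x a0 Aa0) (ap x).
  by exists (exist _ q (conj sq qp)) => a Aa; apply/asboolP => x; exact: qle.
exists u; split=> // q sq qu.
have qp x : q x <= p x by exact: le_trans (qu x) (up x).
have /umin/(congr1 sval) // : below (exist _ u (conj su up)) (exist _ q (conj sq qp)).
exact/asboolP.
Qed.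

(** By [sublinear_shift] a minimal sublinear functional is odd, and an odd sublinear functional is
    linear. Replacing [p] beforehand by its shift at [v] forces u(- v) <= - p(v), that is p(v) <=
    u(v). *)
Lemma real_hahn_banach p v : sublinear p -> exists u : V -> R,
  [/\ forall x y, u (x + y) = u x + u y, forall t x, u (emb K t *: x) = t * u x,
    forall x, u x <= p x & p v <= u v].
Proof.
move=> sp; have [p' [sp' p'p p'v]] := sublinear_shift v sp.
have [u [su up umin]] := minimal_sublinear sp'.
have uN x : u (- x) = - u x.
  have [w [sw wu wx]] := sublinear_shift x su.
  have e := umin w sw wu; apply/eqP; rewrite eq_le -{1}e wx /=.
  by have := sublinear_lb (- x) su; rewrite opprK.
exists u; split.
- move=> x y; apply/eqP; rewrite eq_le su.1 /=.
  by have := su.1 (- x) (- y); rewrite -opprD !uN; lra.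
- move=> t x; have [t0|t0] := lerP 0 t; first exact: su.2.
  have := su.2 (- t) x; rewrite rmorphN scaleNr uN oppr_ge0 mulNr => /(_ (ltW t0)).
  exact: oppr_inj.
- by move=> x; exact: le_trans (up x) (p'p x).
- by have := up (- v); rewrite uN; lra.
Qed.

Lemma re_imag : re K (imag K) = 0.
Proof.
have [->|i2] := imagP K; first by have := reM K 0 0; rewrite mulr0 mul0r.
have := scalarE K (imag K); rewrite mulNr i2 opprK re1 rmorph1 mulr1.
by move/eqP; rewrite -subr_eq subrr eq_sym emb_eq0 => /eqP.
Qed.

(** The classical complexification u(x) - i u(i x), written with [imag] so that it reduces to u over
    the reals. The factor 2 adds the bounds of the two components; the lower bound holds because the
    real part of [phi v] is [u v]. *)
Lemma hahn_banach p v : seminorm K p -> exists phi : V -> k^o,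
  [/\ linear phi, forall x, mag K (phi x) <= 2 * p x & p v <= mag K (phi v)].
Proof.
move=> sp; have [u [uD uZ up uv]] := real_hahn_banach v (seminorm_sublinear sp).
have u0 : u 0 = 0 by rewrite -(scaler0 _ (emb K 0)) uZ mul0r.
have uN x : u (- x) = - u x by rewrite -scaleN1r -(rmorph1 (emb K)) -rmorphN uZ mulN1r.
have uabs x : `|u x| <= p x.
  by rewrite ler_norml up andbT lerNl -uN -(snN sp) up.
pose j := imag K.
pose phi x : k^o := emb K (u x) + j * emb K (u (- j *: x)).
have phiD x y : phi (x + y) = phi x + phi y.
  by rewrite /phi scalerDr !uD !rmorphD mulrDr addrACA.
have phiZ t x : phi (emb K t *: x) = emb K t * phi x.
  rewrite /phi scalerA [- j * _]mulrC -scalerA !uZ !rmorphM mulrDr; congr (_ + _).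
  by rewrite mulrCA.
have phi0 : phi 0 = 0 by rewrite -(scaler0 _ (emb K 0)) phiZ rmorph0 mul0r.
have phij x : phi (j *: x) = j * phi x.
  have [j0|j2] := imagP K; first by rewrite /j j0 scale0r phi0 mul0r.
  rewrite /phi scalerA mulNr j2 opprK scale1r mulrDr mulrA j2 mulN1r.
  by rewrite scaleNr uN rmorphN opprK addrC.
exists phi; split.
- move=> a x y; rewrite phiD; congr (_ + _).
  rewrite {1}(scalarE K a) scalerDl phiD -scalerA phij !phiZ mulrA -mulrDl.
  by rewrite -(scalarE K a).
- move=> x; apply: le_trans (magD _ _ _) _; rewrite magM !mag_emb mulr2n mulrDl !mul1r.
  rewrite lerD// (@le_trans _ _ (`|u (- j *: x)|))//.
    by rewrite ler_piMl// mag_imag.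
  apply: le_trans (uabs _) _; rewrite (snZ sp) ler_piMl ?(sn_ge0 sp)//.
  by rewrite magN mag_imag.
- apply: le_trans uv _; apply: le_trans (ler_norm _) _.
  apply: le_trans (re_le_mag K (phi v)); rewrite /phi reD re_emb mulrC reM.
  by rewrite re_imag mulr0 addr0.
Qed.

End HahnBanach.

(** * Completion, and extension of maps from dense images *)

Section Completion.
Variables (R : realType) (k : numFieldType) (K : scalars R k).

Definition dense_map (V : Type) (X : complete_lcs k) (j : V -> X) : Prop :=
  forall x r e, cs K r -> 0 < e -> exists v, r (j v - x) < e.

(** The gauge attached to [p] is the supremum over the functionals bounded by 2 p, the factor being
    that of [hahn_banach]; on vectors of [V] it lies between p and 2 p. Vectors on which all of [P]
    vanishes are sent to 0, so [j] also performs the Hausdorff quotient. *)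
Lemma completion (V : lmodType k) (P : set (V -> R)) : P !=set0 ->
  (forall p, P p -> seminorm K p) ->
  (forall p q, P p -> P q -> exists2 r, P r & forall v, p v <= r v /\ q v <= r v) ->
  exists (X : complete_lcs k) (j : V -> X), [/\ linear j, dense_map j,
    (forall p, P p -> exists2 r, cs K r & forall v, p v <= r (j v)) &
    forall r, cs K r -> exists p C, [/\ P p, 0 < C & forall v, r (j v) <= C * p v]].
Proof.
move=> P0 Psn Pdir.
pose bdd (phi : V -> k^o) (p : V -> R) := forall v, mag K (phi v) <= 2 * p v.
pose T := {phi : V -> k^o | linear phi /\ exists2 p, P p & bdd phi p}.
pose L p : set (seq (T * R)) := [set [:: (t, 1)] | t in [set t | bdd (sval t) p]].
have w1 (t : T) x : wsum K [:: (t, 1)] x = mag K (x t).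
  by rewrite wsum_cons wsum_nil mul1r addr0.
pose ev v : T -> k^o := fun t => sval t v.
have evlin : linear ev.
  by move=> a v w; apply/funext => t; exact: (svalP t).1.
pose S : set (T -> k^o) := [set x | forall p e, P p -> 0 < e ->
  exists v, forall t, bdd (sval t) p -> mag K (x t - ev v t) <= e].
have Sev v : S (ev v) by move=> p e _ /ltW e0; exists v => t _; rewrite subrr mag0.
have [||||||||X [i [li ii iS rX csX]]] :=
  @function_space R k K T [set L p | p in P] S.
- by have [p Pp] := P0; exists (L p), p.
- move=> _ [p Pp <-]; split; last by move=> _ [t _ <-] [|j]//= _; exact: ler01.
  have z0 : bdd (fun=> 0) p.
    by move=> v; rewrite mag0 mulr_ge0// (sn_ge0 (Psn p Pp)).
  have zP : linear (fun _ : V => 0 : k^o) /\ exists2 p, P p & bdd (fun=> 0) p.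
    by split; [move=> a x y; rewrite scaler0 addr0|exists p].
  pose t0 : T := exist _ (fun=> 0) zP.
  by exists [:: (t0, 1)], t0.
- move=> _ _ [p Pp <-] [q Pq <-]; have [r Pr pqr] := Pdir p q Pp Pq.
  exists (L r); first by exists r.
  by move=> l [] [t tb <-]; exists [:: (t, 1)] => //; exists t => // v;
    apply: le_trans (tb v) _; rewrite ler_pM2l//; have [] := pqr v.
- move=> t; have [_ [p Pp tb]] := svalP t; exists (L p); first by exists p.
  by exists 1 => //; exists t.
- by rewrite -(linear_at0 evlin); exact: Sev.
- move=> a x y Sx Sy p e Pp e0.
  have M0 : 0 < mag K a + 1 by rewrite ltr_wpDl ?mag_ge0.
  have e2 : 0 < e / 2 by rewrite divr_gt0.
  have [v hv] := Sx p _ Pp (divr_gt0 e2 M0); have [w hw] := Sy p _ Pp e2.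
  exists (a *: v + w) => t tb; rewrite evlin.
  have -> : (a *: x + y) t - (a *: ev v + ev w) t =
      a * (x t - ev v t) + (y t - ev w t).
    by rewrite mulrBr opprD addrACA.
  apply: le_trans (magD _ _ _) _; rewrite magM.
  suff : mag K a * mag K (x t - ev v t) <= e / 2 by have := hw t tb; lra.
  apply: (@le_trans _ _ ((mag K a + 1) * mag K (x t - ev v t))).
    by rewrite ler_wpM2r ?mag_ge0// lerDl.
  by rewrite -ler_pdivlMl// mulrC hv.
- move=> x Sx _ [p Pp <-]; have [v hv] := Sx p 1 Pp ltr01.
  exists (1 + 2 * p v) => _ [t tb <-]; rewrite w1.
  have := magD K (x t - ev v t) (ev v t); rewrite subrK => /le_trans; apply.
  by rewrite lerD ?hv//; exact: tb.
- move=> x Sx p e Pp e0; have e2 : 0 < e / 2 by rewrite divr_gt0.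
  have [|y Sy hy] := Sx (L p) _ _ e2; first by exists p.
  have [v hv] := Sy p _ Pp e2; exists v => t tb.
  have h : L p [:: (t, 1)] by exists t.
  have := hy _ h; rewrite w1 -[(x - y) t]/(x t - y t) => hxy.
  by have := magB K (x t) (y t) (ev v t); have := hv t tb; lra.
have /choice[j ij] : forall v, exists u, i u = ev v by move=> v; exact/iS.
have lj : linear j by move=> a v w; apply: ii; rewrite li !ij evlin.
exists X, j; split=> //.
- move=> x r e /csX[sr [_ [C [[p Pp <-] C0 hr]]]] e0.
  have Sx : S (i x) by apply/iS; exists x.
  have e2 : 0 < e / 2 by rewrite divr_gt0.
  have [v hv] := Sx p _ Pp (divr_gt0 e2 C0); exists v.
  apply: (@le_lt_trans _ _ (C * (e / 2 / C))); last first.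
    by rewrite mulrCA divff ?gt_eqF// mulr1; lra.
  apply: hr => _ [t tb <-]; rewrite w1 (linear_sub _ _ li) ij.
  by rewrite -[_ t]/(ev v t - i x t) mag_sub hv.
- move=> p Pp; have [|r cr hr] := rX (L p); first by exists p.
  exists r => // v; have [phi [lphi phip pv]] := hahn_banach v (Psn p Pp).
  have phiT : linear phi /\ exists2 p, P p & bdd phi p by split=> //; exists p.
  pose t0 : T := exist _ phi phiT.
  have := hr (j v) [:: (t0, 1)]; rewrite w1 ij => h.
  by apply: le_trans pv _; apply: h; exists t0.
- move=> r /csX[sr [_ [C [[p Pp <-] C0 hr]]]]; exists p, (C * 2).
  split=> //; first by rewrite mulr_gt0.
  by move=> v; rewrite -mulrA; apply: hr => _ [t tb <-]; rewrite w1 ij; exact: tb.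
Qed.

Lemma dense_map_eq (V : Type) (X Y : complete_lcs k) (j : V -> X)
    (G H : clin X Y) :
  dense_map j -> (forall v, G (j v) = H (j v)) -> G = H.
Proof.
move=> dj GH; apply: clin_eq => x; apply/eqP; rewrite -subr_eq0; apply/eqP.
apply: (@lcs_separated R k K Y) => q cq.
apply/eqP; rewrite eq_le (sn_ge0 cq.1) andbT; apply/ler_addgt0Pl => e e0.
rewrite addr0.
have [v] := dj x _ e (csD (clin_cs G cq) (clin_cs H cq)) e0.
rewrite /= !(linear_sub _ _ (@clin_linear _ _ _ _)) -GH => hv.
have := snB cq.1 (G (j v)) (G x) (H x).
by rewrite (sn_sub cq.1 (G x) (G (j v))); lra.
Qed.

(** The value at [x] is characterised by [rel x y], the family of estimates that it must inherit
    from q(g v) <= r(j v). Density makes such a [y] unique, completeness of [Y] makes it exist, and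
    linearity follows from uniqueness. *)
Lemma extension (V : lmodType k) (X Y : complete_lcs k) (j : V -> X) (g : V -> Y) :
  linear j -> dense_map j -> linear g ->
  (forall q, cs K q -> exists2 r, cs K r & forall v, q (g v) <= r (j v)) ->
  exists G : clin X Y, forall v, G (j v) = g v.
Proof.
move=> lj dj lg gd.
pose dom q r := [/\ cs K q, cs K r & forall v, q (g v) <= r (j v)].
pose rel x y := forall q r, dom q r -> forall v, q (g v - y) <= r (j v - x).
have relj v : rel (j v) (g v).
  by move=> q r [_ _ qr] w; rewrite -(linear_sub _ _ lg) -(linear_sub _ _ lj).
have rel_uniq x y z : rel x y -> rel x z -> y = z.
  move=> xy xz; apply/eqP; rewrite -subr_eq0; apply/eqP.
  apply: (@lcs_separated R k K Y) => q cq; have [r cr qr] := gd q cq.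
  apply/eqP; rewrite eq_le (sn_ge0 cq.1) andbT; apply/ler_addgt0Pl => e e0.
  rewrite addr0; have e2 : 0 < e / 2 by rewrite divr_gt0.
  have [v hv] := dj x r _ cr e2; have qr' : dom q r by [].
  have := snB cq.1 (g v) y z; rewrite (sn_sub cq.1 y (g v)).
  by have := xy q r qr' v; have := xz q r qr' v; lra.
have rel_ex x : exists y, rel x y.
  pose F : set_system Y := [set B | exists r e, [/\ cs K r, 0 < e &
    forall v, r (j v - x) < e -> B (g v)]].
  have FF : ProperFilter F.
    split; first by move=> [r [e [cr e0 h]]]; have [v /h] := dj x r e cr e0.
    split.
    - by exists (fun=> 0), 1; split=> //; exact: cs0.
    - move=> A B [r [e [cr e0 hA]]] [s [f [c_s f0 hB]]].
      exists (fun v => r v + s v), (Num.min e f).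
      split; [exact: csD|by rewrite lt_min e0|].
      move=> v; rewrite lt_min => /andP[he hf].
      have := sn_ge0 cr.1 (j v - x); have := sn_ge0 c_s.1 (j v - x) => s0 r0.
      by split; [apply: hA|apply: hB]; move: he hf; lra.
    - by move=> A B AB [r [e [cr e0 hA]]]; exists r, e; split=> // v /hA /AB.
  have [|y Fy] := @lcs_cauchy_lim R k K Y F FF.
    move=> q cq e e0; have [r cr qr] := gd q cq.
    have e2 : 0 < e / 2 by rewrite divr_gt0.
    have [v hv] := dj x r _ cr e2; exists (g v), r, (e / 2); split=> // w hw.
    rewrite /= -(linear_sub _ _ lg); apply: le_lt_trans (qr _) _.
    rewrite (linear_sub _ _ lj).
    by have := snB cr.1 x (j w) (j v); rewrite (sn_sub cr.1 x (j v)); lra.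
  (* Passage to the limit: [w] is chosen with [j w] near [x] and [g w] near [y], and [qr] is applied
     to [v - w]. *)
  exists y => q r [cq cr qr] v; apply/ler_addgt0Pr => d d0.
  have d2 : 0 < d / 2 by rewrite divr_gt0.
  have [s [e [c_s e0 hs]]] := Fy q cq _ d2.
  have m0 : 0 < Num.min (d / 2) e by rewrite lt_min d2.
  have [w] := dj x _ _ (csD cr c_s) m0; rewrite lt_min => /andP[w1 w2].
  have r0 := sn_ge0 cr.1 (j w - x); have s0 := sn_ge0 c_s.1 (j w - x).
  have sw : s (j w - x) < e by move: w2; lra.
  have /= hw := hs w sw; have h1 := snB cq.1 (g w) (g v) y.
  have h2 := qr (v - w); rewrite (linear_sub _ _ lg) (linear_sub _ _ lj) in h2.
  have h3 := snB cr.1 x (j v) (j w); rewrite (sn_sub cr.1 x (j w)) in h3.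
  by move: w1; lra.
have [G relG] := choice rel_ex.
have lG : linear G.
  move=> a x y; apply: (rel_uniq _ _ _ (relG _)) => q r qr v.
  have [cq cr qr'] := qr; apply/ler_addgt0Pr => d d0.
  pose M := mag K a + 1; have M0 : 0 < M by rewrite ltr_wpDl ?mag_ge0.
  have e0 : 0 < d / 2 / M by rewrite !divr_gt0.
  have [v1 h1] := dj x r _ cr e0; have [v2 h2] := dj y r _ cr e0.
  pose w := a *: v1 + v2.
  have jw : j w - (a *: x + y) = a *: (j v1 - x) + (j v2 - y).
    by rewrite lj scalerBr opprD addrACA.
  have gw : g w - (a *: G x + G y) = a *: (g v1 - G x) + (g v2 - G y).
    by rewrite lg scalerBr opprD addrACA.
  have bnd : mag K a * r (j v1 - x) + r (j v2 - y) <= d / 2.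
    have -> : d / 2 = mag K a * (d / 2 / M) + d / 2 / M.
      by rewrite -[X in _ = _ + X]mul1r -mulrDl -/M [RHS]mulrC divfK// gt_eqF.
    by rewrite lerD ?(ltW h2)// ler_wpM2l ?mag_ge0 ?ltW.
  have hg := snD cq.1 (a *: (g v1 - G x)) (g v2 - G y).
  have hj := snD cr.1 (a *: (j v1 - x)) (j v2 - y).
  rewrite -gw (snZ cq.1) in hg; rewrite -jw (snZ cr.1) in hj.
  have k1 : mag K a * q (g v1 - G x) <= mag K a * r (j v1 - x).
    by rewrite ler_wpM2l ?mag_ge0//; exact: relG.
  have k2 := relG y q r qr v2.
  have h3 := snB cq.1 (g w) (g v) (a *: G x + G y).
  have h4 := qr' (v - w); rewrite (linear_sub _ _ lg) (linear_sub _ _ lj) in h4.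
  have h5 := snB cr.1 (a *: x + y) (j v) (j w).
  by rewrite (sn_sub cr.1 (a *: x + y) (j w)) in h5; move: hg hj bnd k1 k2 h3 h4 h5; lra.
have [H HG] : exists H : clin X Y, H =1 G.
  apply: (clin_of lG (K := K)) => q cq; have [r cr qr] := gd q cq.
  have qr' : dom q r by [].
  apply: (@cs_le R k K X _ r 1 cr); first exact: (seminorm_comp lG cq.1).
  move=> x /=; rewrite mul1r; apply/ler_addgt0Pr => d d0.
  have d2 : 0 < d / 2 by rewrite divr_gt0.
  have [v hv] := dj x r _ cr d2.
  have h1 := relG x q r qr' v; have h2 := qr v.
  have h3 := sn_le cq.1 (G x) (g v); rewrite (sn_sub cq.1 (G x) (g v)) in h3.
  by have h4 := sn_le cr.1 (j v) x; lra.
by exists H => v; rewrite HG; apply: (rel_uniq _ _ _ (relG _)); exact: relj.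
Qed.

End Completion.

(** * Kernels, cokernels and biproducts *)

Section PreAbelian.
Variables (R : realType) (k : numFieldType) (K : scalars R k).
Local Open Scope cat_scope.
Local Notation COMk := (COM k).
Implicit Types A B X Y : COMk.

Lemma comp_eq0 A B X (g : hom B X) (f : hom A B) :
  g \oc f = 0 <-> forall x, g (f x) = 0.
Proof.
split=> [gf x|gf]; last by apply: clin_eq => x; exact: gf.
by have := congr1 (fun h : clin A X => h x) gf.
Qed.

Lemma comp_eq A B X (g : hom B X) (f : hom A B) (h : hom A X) :
  g \oc f = h <-> forall x, g (f x) = h x.
Proof. by split=> [<-//|gf]; apply: clin_eq => x; exact: gf. Qed.

(** Topological embeddings phrased by seminorms; injectivity is automatic because the spaces are
    Hausdorff. *)
Definition embedding A B (i : hom A B) : Prop :=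
  forall q, cs K q -> exists2 p, cs K p & forall x, q x <= p (i x).

Lemma embedding_inj A B (i : hom A B) : embedding i -> injective i.
Proof.
move=> ei x y ixy; apply/eqP; rewrite -subr_eq0; apply/eqP.
apply: (@lcs_separated R k K A) => q cq; have [p cp qp] := ei q cq.
apply/eqP; rewrite eq_le (sn_ge0 cq.1) andbT (le_trans (qp _))//.
by rewrite (linear_sub _ _ (clin_linear i)) ixy subrr (sn0 cp.1).
Qed.

Lemma embedding_lift A B X (i : hom A B) (g : hom X B) : embedding i ->
  (forall x, exists a, i a = g x) -> exists h : hom X A, i \oc h = g.
Proof.
move=> ei /choice[h ih].
have lh : linear h.
  move=> a x y; apply: (embedding_inj ei).
  by rewrite (clin_linear i) !ih (clin_linear g).
have [|H Hh] := @clin_of R k K X A h lh; last first.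
  by exists H; apply/comp_eq => x; rewrite Hh ih.
move=> q cq; have [p cp qp] := ei q cq.
apply: (@cs_le R k K X _ (p \o g) 1 (clin_cs g cp)).
  exact: (seminorm_comp lh cq.1).
by move=> x /=; rewrite mul1r -ih.
Qed.

Lemma embedding_kernel A B X (i : hom X A) (f : hom A B) : embedding i ->
  (forall x, f x = 0 <-> exists u, i u = x) -> is_kernel_of i f.
Proof.
move=> ei fi; split; first by apply/comp_eq0 => u; apply/fi; exists u.
move=> Y g /comp_eq0 fg; have [x|h ih] := embedding_lift ei (g := g).
  exact/fi/fg.
exists h; split=> // h' ih'; apply: clin_eq => y; apply: (embedding_inj ei).
by move: ih ih' => /comp_eq -> /comp_eq ->.
Qed.

(** The subspace carries the restrictions of all continuous seminorms of [A]; a Cauchy filter on it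
    converges in [A], and closedness keeps the limit in [S]. *)
Lemma closed_subspace A (S : set A) : S 0 ->
  (forall a x y, S x -> S y -> S (a *: x + y)) ->
  (forall x, (forall p e, cs K p -> 0 < e -> exists2 y, S y & p (y - x) < e) ->
    S x) ->
  exists X (i : hom X A), embedding i /\ forall x, S x <-> exists u, i u = x.
Proof.
move=> S0 Slin Scl; pose D : {pred (A : tvsType k)} := fun x => `[< S x >].
have Dsub : submod_closed D.
  split; first exact/asboolP.
  by move=> a x y /asboolP Sx /asboolP Sy; apply/asboolP; exact: Slin.
have ne : [set p : A -> R | cs K p] !=set0 by exists (fun=> 0); exact: cs0.
have gD (p : A -> R) (x y : A) : [set p | cs K p] p -> x \in D -> y \in D ->
    p (x + y) <= p x + p y.
  by move=> cp _ _; exact: (snD cp.1).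
have gZ (p : A -> R) a (x : A) : [set p | cs K p] p -> x \in D ->
    p (a *: x) = mag K a * p x.
  by move=> cp _; exact: (snZ cp.1).
have gdir (p q : A -> R) : [set p | cs K p] p -> [set p | cs K p] q ->
    exists2 r, [set p | cs K p] r & forall x, x \in D -> p x <= r x /\ q x <= r x.
  move=> cp cq; exists (fun x => p x + q x); first exact: csD.
  by move=> x _; rewrite lerDl lerDr (sn_ge0 cp.1) (sn_ge0 cq.1).
have [||X [i [li ii iS csX]]] :=
    @gauged_lcs R k K A (Gauged Dsub ne gD gZ gdir).
- by move=> x /= _; exact: lcs_separated.
- move=> F FF /= FD Fc; have FS : F S by apply: filterS FD => x /asboolP.
  have [|x Fx] := @lcs_cauchy_lim R k K A F FF.
    by move=> p cp e e0; have [x _ Fx] := Fc p cp e e0; exists x.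
  exists x => //; apply/asboolP; apply: Scl => p e cp e0.
  by have [y [Sy py]] := filter_ex (filterI FS (Fx p cp e e0)); exists y.
have [|I Ii] := @clin_of R k K X A i li.
  move=> p cp; apply/csX; split; first exact: (seminorm_comp li cp.1).
  by exists p, 1; split=> // x /=; rewrite mul1r.
exists X, I; split=> [q /csX[sq [p [C [/= cp C0 qp]]]]|x].
  exists (fun x => C * p x); last by move=> x; rewrite Ii.
  apply: (@cs_le R k K A _ p C cp) => //.
  split=> [x y|a x]; last by rewrite (snZ cp.1) mulrCA.
  by rewrite -mulrDr ler_pM2l//; exact: (snD cp.1).
split=> [Sx|[u <-]].
  by have [u iu] := (iS x).1 (asboolT Sx); exists u; rewrite Ii.
by rewrite Ii; apply/asboolP; apply/iS; exists u.
Qed.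

Lemma kernel_ex A B (f : hom A B) :
  exists X (i : hom X A), embedding i /\ forall x, f x = 0 <-> exists u, i u = x.
Proof.
apply: (@closed_subspace A [set x | f x = 0]).
- exact: (linear_at0 (clin_linear f)).
- by move=> a x y /= fx fy; rewrite (clin_linear f) fx fy scaler0 addr0.
- move=> x clx; apply: (@lcs_separated R k K B) => q cq.
  apply/eqP; rewrite eq_le (sn_ge0 cq.1) andbT; apply/ler_addgt0Pl => e e0.
  rewrite addr0; have [y /= fy] := clx _ e (clin_cs f cq) e0.
  by rewrite /= (linear_sub _ _ (clin_linear f)) fy sub0r (snN cq.1) => /ltW.
Qed.

(** By the universal property, any kernel of [f] factors through the embedding of [kernel_ex] and
    conversely; the seminorm estimate is carried along the resulting isomorphism. *)
Lemma kernel_embedding A B X (i : hom X A) (f : hom A B) :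
  is_kernel_of i f -> embedding i.
Proof.
move=> [fi ker]; have [Y [j [ej fj]]] := kernel_ex f.
have fj0 : f \oc j = 0 by apply/comp_eq0 => u; apply/fj; exists u.
have [h [/comp_eq ih _]] := ker Y j fj0.
have [x|g /comp_eq jg] := embedding_lift ej (g := i).
  by apply/fj; move/comp_eq0: fi; exact.
have [h0 [_ idu]] := ker X i fi.
have hg : h \oc g = idm X.
  have i1 : i \oc idm X = i by exact: comp_idr.
  have i2 : i \oc (h \oc g) = i by apply/comp_eq => x; rewrite ih jg.
  by rewrite -(idu _ i1) -(idu _ i2).
move=> q cq; have [p cp qp] := ej (q \o h) (clin_cs h cq).
exists p => // x; have := qp (g x); rewrite /= jg.
by move/comp_eq: hg => ->.
Qed.

Lemma zero_object : exists Z : COMk, is_zero_object Z.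
Proof.
pose D : {pred k^o} := [pred x | x == 0].
have Dsub : submod_closed D.
  split; first exact: eqxx.
  by move=> a x y /eqP -> /eqP ->; rewrite scaler0 addr0 inE.
have ne : [set (fun=> 0) : k^o -> R] !=set0 by exists (fun=> 0).
have gD (p : k^o -> R) (x y : k^o) : [set (fun=> 0 : R)] p -> x \in D -> y \in D ->
    p (x + y) <= p x + p y.
  by move=> -> _ _; rewrite addr0.
have gZ (p : k^o -> R) a (x : k^o) : [set (fun=> 0 : R)] p -> x \in D ->
    p (a *: x) = mag K a * p x.
  by move=> -> _; rewrite mulr0.
have gdir (p q : k^o -> R) : [set (fun=> 0 : R)] p -> [set (fun=> 0 : R)] q ->
    exists2 r, [set (fun=> 0 : R)] r & forall x, x \in D -> p x <= r x /\ q x <= r x.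
  by move=> -> ->; exists (fun=> 0).
have [||Z [i [li ii iD _]]] :=
    @gauged_lcs R k K k^o (Gauged Dsub ne gD gZ gdir).
- by move=> x /eqP.
- move=> F FF _ _; exists 0; first exact: eqxx.
  by move=> p -> e e0; apply: filterS filterT => y _.
have Z0 (z : Z) : z = 0.
  by apply: ii; rewrite (linear_at0 li); apply/eqP; apply/(iD (i z)); exists z.
exists Z => X; split; exists 0; split=> // f _; apply: clin_eq => x.
  by rewrite (Z0 x) [RHS](linear_at0 (clin_linear f)).
by rewrite (Z0 (f x)) (Z0 ((0 : clin X Z) x)).
Qed.

Lemma biproduct_ex A B : exists P (i1 : hom A P) (i2 : hom B P) (p1 : hom P A)
  (p2 : hom P B), is_biproduct i1 i2 p1 p2.
Proof.
pose V : lmodType k := ((A : tvsType k) * (B : tvsType k))%type.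
pose D : {pred V} := fun=> true.
pose G : set (V -> R) := [set r | exists p q, [/\ cs K p, cs K q &
  r = fun v : V => p v.1 + q v.2]].
have Dsub : submod_closed D by [].
have ne : G !=set0.
  by exists (fun v => 0 + 0), (fun=> 0), (fun=> 0); split=> //; exact: cs0.
have gD (r : V -> R) (x y : V) : G r -> x \in D -> y \in D -> r (x + y) <= r x + r y.
  move=> [p [q [cp cq ->]]] _ _; rewrite addrACA.
  by rewrite lerD//; [exact: (snD cp.1)|exact: (snD cq.1)].
have gZ (r : V -> R) a (x : V) : G r -> x \in D -> r (a *: x) = mag K a * r x.
  by move=> [p [q [cp cq ->]]] _; rewrite mulrDr -(snZ cp.1) -(snZ cq.1).
have gdir (r s : V -> R) : G r -> G s ->
    exists2 t, G t & forall x, x \in D -> r x <= t x /\ s x <= t x.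
  move=> [p [q [cp cq ->]]] [p' [q' [cp' cq' ->]]].
  exists (fun v : V => (p v.1 + p' v.1) + (q v.2 + q' v.2)).
    exists (fun x => p x + p' x), (fun x => q x + q' x).
    by split=> //; exact: csD.
  move=> x _; have := sn_ge0 cp.1 x.1; have := sn_ge0 cp'.1 x.1.
  have := sn_ge0 cq.1 x.2; have := sn_ge0 cq'.1 x.2.
  by move=> ? ? ? ?; split; lra.
have [||P [i [li ii iD csP]]] :=
    @gauged_lcs R k K V (Gauged Dsub ne gD gZ gdir).
- move=> x _ x0; have [x1 x2] : x.1 = 0 /\ x.2 = 0.
    split; apply: (@lcs_separated R k K) => p cp.
      have := x0 (fun v : V => p v.1 + 0); rewrite /= addr0; apply.
      by exists p, (fun=> 0); split=> //; exact: cs0.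
    have := x0 (fun v : V => 0 + p v.2); rewrite /= add0r; apply.
    by exists (fun=> 0), p; split=> //; exact: cs0.
  by rewrite (surjective_pairing x) x1 x2.
- move=> F FF /= FD Fc.
  have F1 : ProperFilter (fst @ F : set_system A) by exact: fmap_proper_filter.
  have F2 : ProperFilter (snd @ F : set_system B) by exact: fmap_proper_filter.
  have [|x Fx] := @lcs_cauchy_lim R k K A (fst @ F) F1.
    move=> p cp e e0; have [|v _ Fv] := Fc (fun v : V => p v.1 + 0) _ e e0.
      by exists p, (fun=> 0); split=> //; exact: cs0.
    exists v.1; have : F [set w | p (w.1 - v.1) < e]; last by [].
    by apply: filterS Fv => w /=; rewrite addr0.
  have [|y Fy] := @lcs_cauchy_lim R k K B (snd @ F) F2.
    move=> p cp e e0; have [|v _ Fv] := Fc (fun v : V => 0 + p v.2) _ e e0.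
      by exists (fun=> 0), p; split=> //; exact: cs0.
    exists v.2; have : F [set w | p (w.2 - v.2) < e]; last by [].
    by apply: filterS Fv => w /=; rewrite add0r.
  exists (x, y) => // _ [p [q [cp cq ->]]] e e0.
  have e2 : 0 < e / 2 by rewrite divr_gt0.
  have Fx' : F [set v | p (v.1 - x) < e / 2] := Fx p cp _ e2.
  have Fy' : F [set v | q (v.2 - y) < e / 2] := Fy q cq _ e2.
  apply: filterS (filterI Fx' Fy') => v /= [h1 h2].
  by move: h1 h2; rewrite /=; lra.
have iK v : exists u, i u = v by apply/iD.
have /choice[j ij] := iK.
have ji u : j (i u) = u by apply: ii; rewrite ij.
have lj : linear j by move=> a v w; apply: ii; rewrite li !ij.
have csj r : cs K r -> exists p q C, [/\ cs K p, cs K q, 0 < C &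
    forall v, r (j v) <= C * (p v.1 + q v.2)].
  move=> /csP[sr [_ [C [/= [p [q [cp cq ->]]] C0 h]]]].
  by exists p, q, C; split=> // v; rewrite -{2 3}(ij v).
have csi p q : cs K p -> cs K q -> cs K (fun u : P => p (i u).1 + q (i u).2).
  move=> cp cq; apply/csP; split.
    have sG : seminorm K (fun v : V => p v.1 + q v.2).
      have Gpq : G (fun v : V => p v.1 + q v.2) by exists p, q.
      by split=> [x y|a x]; [exact: (gD _ x y Gpq)|exact: (gZ _ a x Gpq)].
    exact: (seminorm_comp li sG).
  exists (fun v : V => p v.1 + q v.2), 1; split=> //; last by move=> u; rewrite mul1r.
  by exists p, q.
have l1 : linear (fun x : A => j (x, 0)).
  by move=> a x y; rewrite -lj; congr j; apply: injective_projections;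
    rewrite //= scaler0 addr0.
have l2 : linear (fun y : B => j (0, y)).
  by move=> a x y; rewrite -lj; congr j; apply: injective_projections;
    rewrite //= scaler0 addr0.
have [|I1 I1E] := @clin_of R k K A P _ l1.
  move=> r cr; have [p [q [C [cp cq C0 h]]]] := csj r cr.
  apply: (@cs_le R k K A _ p C cp); first exact: (seminorm_comp l1 cr.1).
  by move=> x /=; have := h (x, 0); rewrite /= (sn0 cq.1) addr0.
have [|I2 I2E] := @clin_of R k K B P _ l2.
  move=> r cr; have [p [q [C [cp cq C0 h]]]] := csj r cr.
  apply: (@cs_le R k K B _ q C cq); first exact: (seminorm_comp l2 cr.1).
  by move=> x /=; have := h (0, x); rewrite /= (sn0 cp.1) add0r.
have m1 : linear (fun u : P => (i u).1) by move=> a u v; rewrite li.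
have m2 : linear (fun u : P => (i u).2) by move=> a u v; rewrite li.
have [|P1 P1E] := @clin_of R k K P A _ m1.
  move=> p cp; apply: (@cs_le R k K P _ _ 1 (csi p _ cp (cs0 K B))).
    exact: (seminorm_comp m1 cp.1).
  by move=> u /=; rewrite mul1r addr0.
have [|P2 P2E] := @clin_of R k K P B _ m2.
  move=> p cp; apply: (@cs_le R k K P _ _ 1 (csi _ p (cs0 K A) cp)).
    exact: (seminorm_comp m2 cp.1).
  by move=> u /=; rewrite mul1r add0r.
exists P, I1, I2, P1, P2; split.
- by apply/comp_eq => x; rewrite P1E I1E ij.
- by apply/comp_eq => x; rewrite P2E I2E ij.
- by apply/comp_eq0 => x; rewrite P1E I2E ij.
- by apply/comp_eq0 => x; rewrite P2E I1E ij.
apply: clin_eq => u; transitivity (I1 (P1 u) + I2 (P2 u)) => //.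
rewrite I1E I2E P1E P2E; apply: ii; rewrite (linear_add _ _ li) !ij.
by apply: injective_projections; rewrite /= ?addr0 ?add0r.
Qed.

(** Stated by seminorms because the last clause has two uses: it yields the universal property in
    [dense_cokernel], and it detects the closure of the image of [f] in [embedding_is_kernel]. *)
Lemma cokernel_ex A B (f : hom A B) : exists X (j : hom B X),
  [/\ dense_map K (j : B -> X), forall x, j (f x) = 0 &
    forall p : B -> R, cs K p -> (forall x, p (f x) = 0) ->
      exists2 r, cs K r & forall b, p b <= r (j b)].
Proof.
pose P : set (B -> R) := [set p | cs K p /\ forall x, p (f x) = 0].
have [||p q [cp pf] [cq qf]|X [j [lj dj Pj csj]]] := @completion R k K B P.
- by exists (fun=> 0); split=> //; exact: cs0.
- by move=> p [[]].
- exists (fun x => p x + q x).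
    by split=> [|x]; [exact: csD|rewrite pf qf addr0].
  by move=> x; rewrite lerDl lerDr (sn_ge0 cp.1) (sn_ge0 cq.1).
have [|J Jj] := @clin_of R k K B X j lj.
  move=> r cr; have [p [C [[cp pf] C0 h]]] := csj r cr.
  by apply: (@cs_le R k K B _ p C cp) => //; exact: (seminorm_comp lj cr.1).
exists X, J; split.
- by move=> x r e cr e0; have [v hv] := dj x r e cr e0; exists v; rewrite Jj.
- move=> x; apply: (@lcs_separated R k K X) => r cr.
  have [p [C [[cp pf] C0 h]]] := csj r cr.
  apply/eqP; rewrite eq_le (sn_ge0 cr.1) andbT Jj (le_trans (h _))//.
  by rewrite pf mulr0.
- by move=> p cp pf; have [r cr h] := Pj p (conj cp pf); exists r => // b; rewrite Jj.
Qed.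

(** If g f = 0, every [q \o g] is a continuous seminorm vanishing on the image of [f], hence
    dominated through [j]; [extension] then gives the factorisation and density its uniqueness. *)
Lemma dense_cokernel A B X (f : hom A B) (j : hom B X) :
  dense_map K (j : B -> X) -> (forall x, j (f x) = 0) ->
  (forall p : B -> R, cs K p -> (forall x, p (f x) = 0) ->
    exists2 r, cs K r & forall b, p b <= r (j b)) ->
  is_cokernel_of j f.
Proof.
move=> dj jf jP; split; first exact/comp_eq0.
move=> Y g /comp_eq0 gf.
have [|h hj] := extension (clin_linear j) dj (clin_linear g).
  move=> q cq; apply: (jP _ (clin_cs g cq)) => x /=.
  by rewrite gf (sn0 cq.1).
exists h; split; first exact/comp_eq.
move=> h' /comp_eq h'j; apply: (dense_map_eq dj) => v.
by rewrite h'j hj.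
Qed.

Lemma com_pre_abelian : pre_abelian COMk.
Proof.
split; first by split; [exact: zero_object|exact: biproduct_ex].
move=> A B f; split.
  by have [X [i [ei fi]]] := kernel_ex f; exists X, i; exact: embedding_kernel.
have [X [j [dj jf jP]]] := cokernel_ex f; exists X, j; exact: dense_cokernel.
Qed.

(* A point killed by all continuous seminorms vanishing on the image of an
   embedding lies in the closure of that image, which is complete. *)
Lemma embedding_is_kernel A B (a : hom B A) : embedding a -> is_a_kernel a.
Proof.
move=> ea; have [X [j [dj ja jP]]] := cokernel_ex a; exists X, j.
apply: embedding_kernel => // x; split=> [jx|[u <-]]; last exact: ja.
have la := clin_linear a.
(* The [p]-distance [p'] to the image of [a] is a continuous seminorm vanishing on that image, so it
   is dominated by a seminorm composed with [j]; as j x = 0, it vanishes at [x]. *)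
have close p e : cs K p -> 0 < e -> exists b, p (a b - x) < e.
  move=> cp e0; have p_ge0 := sn_ge0 cp.1.
  pose S y := [set p (y - a b) | b in [set: B]].
  have Sinf y : has_inf (S y).
    by split; [exists (p (y - a 0)), 0|exists 0 => _ [b _ <-]].
  pose p' y := inf (S y).
  have p'le y b : p' y <= p (y - a b).
    by apply: (ge_inf (Sinf y).2); exists b.
  have p'ge y c : (forall b, c <= p (y - a b)) -> c <= p' y.
    by move=> h; apply: lb_le_inf; [exact: (Sinf y).1|move=> _ [b _ <-]].
  have p'Z c y : c != 0 -> p' (c *: y) <= mag K c * p' y.
    move=> c0; rewrite -ler_pdivrMl ?mag_gt0//; apply: p'ge => b.
    rewrite ler_pdivrMl ?mag_gt0// -(snZ cp.1) scalerBr.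
    by rewrite -(linear_scale _ _ la); exact: p'le.
  have p'a b : p' (a b) = 0.
    apply/eqP; rewrite eq_le; apply/andP; split; last exact: p'ge.
    by have := p'le (a b) b; rewrite subrr (sn0 cp.1).
  have sp' : seminorm K p'.
    split=> [y z|c y].
      rewrite -lerBlDr; apply: (p'ge) => b; rewrite lerBlDr [leRHS]addrC -lerBlDr.
      apply: (p'ge) => b'; rewrite lerBlDr.
      have := p'le (y + z) (b + b').
      rewrite (linear_add _ _ la) opprD addrACA.
      by have := snD cp.1 (y - a b) (z - a b'); lra.
    have [->|c0] := eqVneq c 0.
      by rewrite scale0r mag0 mul0r -(linear_at0 la).
    apply/eqP; rewrite eq_le p'Z//= -ler_pdivlMl ?mag_gt0//.
    have := p'Z c^-1 (c *: y); rewrite scalerA mulVf// scale1r invr_eq0 => /(_ c0).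
    move=> /le_trans; apply; rewrite ler_wpM2r ?p'ge//.
    rewrite -(ler_pM2r (_ : 0 < mag K c)) ?mag_gt0// -magM !mulVf ?mag_eq0//.
    by rewrite mag1.
  have cp' : cs K p'.
    apply: (@cs_le R k K A _ p 1 cp) => // y; rewrite mul1r.
    by have := p'le y 0; rewrite (linear_at0 la) subr0.
  have [r cr hr] := jP p' cp' p'a.
  have p'x : p' x < e.
    by apply: le_lt_trans (hr x) _; rewrite jx (sn0 cr.1).
  have [_ [b _ <-] hb] := inf_lt (Sinf x).1 p'x.
  by exists b; rewrite (sn_sub cp.1).
(* The filter of all [b] with [a b] close to [x]. It is Cauchy in [B] because [a] is an embedding,
   and [a] sends its limit to [x]. *)
pose F : set_system B := [set Q | exists p e, [/\ cs K p, 0 < e &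
  forall b, p (a b - x) < e -> Q b]].
have FF : ProperFilter F.
  split; first by move=> [p [e [cp e0 h]]]; have [b /h] := close p e cp e0.
  split.
  - by exists (fun=> 0), 1; split=> //; exact: cs0.
  - move=> Q1 Q2 [p [e [cp e0 h1]]] [q [f [cq f0 h2]]].
    exists (fun v => p v + q v), (Num.min e f).
    split; [exact: csD|by rewrite lt_min e0|].
    move=> b; rewrite lt_min => /andP[he hf].
    have := sn_ge0 cp.1 (a b - x); have := sn_ge0 cq.1 (a b - x) => q0 p0.
    by split; [apply: h1|apply: h2]; move: he hf; lra.
  - by move=> Q1 Q2 Q12 [p [e [cp e0 h]]]; exists p, e; split=> // b /h /Q12.
have [|b0 Fb0] := @lcs_cauchy_lim R k K B F FF.
  move=> q cq e e0; have [p cp qp] := ea q cq.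
  have e2 : 0 < e / 2 by rewrite divr_gt0.
  have [b hb] := close p _ cp e2; exists b, p, (e / 2); split=> // b' hb' /=.
  apply: le_lt_trans (qp _) _; rewrite (linear_sub _ _ la).
  have := snB cp.1 x (a b') (a b); rewrite (sn_sub cp.1 x (a b)); lra.
exists b0; apply/eqP; rewrite -subr_eq0; apply/eqP.
apply: (@lcs_separated R k K A) => p cp.
apply/eqP; rewrite eq_le (sn_ge0 cp.1) andbT; apply/ler_addgt0Pl => e e0.
rewrite addr0; have e2 : 0 < e / 2 by rewrite divr_gt0.
have [q [f [cq f0 hq]]] := Fb0 (p \o a) (clin_cs a cp) _ e2.
have m0 : 0 < Num.min (e / 2) f by rewrite lt_min e2.
have [b] := close _ _ (csD cp cq) m0; rewrite lt_min => /andP[h1 h2].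
have p0 := sn_ge0 cp.1 (a b - x); have q0 := sn_ge0 cq.1 (a b - x).
have qb : q (a b - x) < f by move: h2; lra.
have := hq b qb; rewrite /= (linear_sub _ _ la) => h3.
have := snB cp.1 (a b) (a b0) x; rewrite (sn_sub cp.1 (a b0) (a b)).
by move: h1; lra.
Qed.

End PreAbelian.

(** * Kernels are stable under pushout *)

Section RightQuasiAbelian.
Variables (R : realType) (k : numFieldType) (K : scalars R k).
Local Open Scope cat_scope.

(* The map into the completion of B x C' for the seminorm
   (y, z) |-> inf_x q (y + c x) + r (z - d x) factors through the pushout, and
   this seminorm restricts to q on B as soon as q o c <= r o d. *)
Lemma pushout_embedding (A B C' D : COM k) (a : hom B A) (b : hom C' A)
    (c : hom D B) (d : hom D C') :
  is_pushout a b c d -> embedding K d -> embedding K a.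
Proof.
move=> [_ univ] ed q cq; have [r cr qr] := ed _ (clin_cs c cq).
have lc := clin_linear c; have ld := clin_linear d.
pose V : lmodType k := ((B : tvsType k) * (C' : tvsType k))%type.
pose f (v : V) x := q (v.1 + c x) + r (v.2 - d x).
pose S v := [set f v x | x in [set: D]].
have f_ge0 v x : 0 <= f v x by rewrite addr_ge0 ?(sn_ge0 cq.1) ?(sn_ge0 cr.1).
have Sinf v : has_inf (S v).
  by split; [exists (f v 0), 0|exists 0 => _ [x _ <-]].
pose p v := inf (S v).
have ple v x : p v <= f v x by apply: (ge_inf (Sinf v).2); exists x.
have pge v e : (forall x, e <= f v x) -> e <= p v.
  by move=> h; apply: lb_le_inf; [exact: (Sinf v).1|move=> _ [x _ <-]].
have fZ s v x : f (s *: v) (s *: x) = mag K s * f v x.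
  rewrite /f (linear_scale _ _ lc) (linear_scale _ _ ld) /= -scalerDr -scalerBr.
  by rewrite (snZ cq.1) (snZ cr.1) mulrDr.
have pZ s v : s != 0 -> p (s *: v) <= mag K s * p v.
  move=> s0; rewrite -ler_pdivrMl ?mag_gt0//; apply: pge => x.
  by rewrite ler_pdivrMl ?mag_gt0// -fZ.
have p0 : p 0 = 0.
  apply/eqP; rewrite eq_le (pge 0)// andbT (le_trans (ple 0 0))// /f.
  rewrite (linear_at0 lc) (linear_at0 ld) /= subr0 addr0.
  by rewrite (sn0 cq.1) (sn0 cr.1) addr0.
have sp : seminorm K p.
  split=> [v w|s v].
    rewrite -lerBlDr; apply: (pge) => x; rewrite lerBlDr [leRHS]addrC -lerBlDr.
    apply: (pge) => y; rewrite lerBlDr; apply: le_trans (ple _ (x + y)) _.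
    rewrite /f (linear_add _ _ lc) (linear_add _ _ ld) /= opprD.
    rewrite [v.1 + w.1 + _]addrACA [v.2 + w.2 + _]addrACA.
    have := snD cq.1 (v.1 + c x) (w.1 + c y).
    have := snD cr.1 (v.2 - d x) (w.2 - d y); lra.
  have [->|s0] := eqVneq s 0; first by rewrite scale0r mag0 mul0r.
  apply/eqP; rewrite eq_le pZ//= -ler_pdivlMl ?mag_gt0//.
  have := pZ s^-1 (s *: v); rewrite scalerA mulVf// scale1r invr_eq0 => /(_ s0).
  move=> /le_trans; apply; rewrite ler_wpM2r ?pge//.
  rewrite -(ler_pM2r (_ : 0 < mag K s)) ?mag_gt0// -magM !mulVf ?mag_eq0//.
  by rewrite mag1.
have [|_ ->//|_ _ -> ->|X [j [lj _ Pj csj]]] := @completion R k K V [set p].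
- by exists p.
- by exists p.
have jC s : cs K s -> exists2 C, 0 < C & forall v, s (j v) <= C * p v.
  by move=> /csj[_ [C [-> C0 h]]]; exists C.
have lu : linear (fun y : B => j (y, 0)).
  by move=> s y z; rewrite -lj; congr j; apply: injective_projections;
    rewrite //= scaler0 addr0.
have lv : linear (fun z : C' => j (0, z)).
  by move=> s y z; rewrite -lj; congr j; apply: injective_projections;
    rewrite //= scaler0 addr0.
have [|u uE] := @clin_of R k K B X _ lu.
  move=> s c_s; have [C C0 h] := jC s c_s.
  apply: (@cs_le R k K B _ q C cq); first exact: (seminorm_comp lu c_s.1).
  move=> y /=; apply: le_trans (h _) _; rewrite ler_pM2l//.
  apply: le_trans (ple _ 0) _; rewrite /f (linear_at0 lc) (linear_at0 ld) /=.
  by rewrite subr0 addr0 (sn0 cr.1) addr0.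
have [|v vE] := @clin_of R k K C' X _ lv.
  move=> s c_s; have [C C0 h] := jC s c_s.
  apply: (@cs_le R k K C' _ r C cr); first exact: (seminorm_comp lv c_s.1).
  move=> y /=; apply: le_trans (h _) _; rewrite ler_pM2l//.
  apply: le_trans (ple _ 0) _; rewrite /f (linear_at0 lc) (linear_at0 ld) /=.
  by rewrite subr0 addr0 (sn0 cq.1) add0r.
(* The vector (c x, - d x) has [p]-value 0, as the choice of [- x] in the infimum shows. *)
have uv : @compm (COM k) D B X u c = @compm (COM k) D C' X v d.
  apply/comp_eq => x; rewrite uE.
  transitivity (v (d x)) => //; rewrite vE.
  apply/eqP; rewrite -subr_eq0 -(linear_sub _ _ lj); apply/eqP.
  apply: (@lcs_separated R k K X) => s c_s; have [C C0 h] := jC s c_s.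
  apply/eqP; rewrite eq_le (sn_ge0 c_s.1) andbT (le_trans (h _))//.
  rewrite pmulr_rle0// (le_trans (ple _ (- x)))// /f.
  rewrite -[- x]sub0r (linear_sub _ _ lc) (linear_sub _ _ ld) (linear_at0 lc).
  rewrite (linear_at0 ld) !sub0r /=.
  by rewrite subr0 sub0r opprK subrr addNr (sn0 cq.1) (sn0 cr.1) addr0.
have [w [[/comp_eq wa _] _]] := univ _ _ _ uv.
have [s c_s ps] := Pj p erefl.
exists (s \o w); first exact: (clin_cs w c_s).
(* Here p(y, 0) >= q(y), since q(y + c x) + r(- d x) is at least q(y + c x) + q(c x). *)
move=> y /=; rewrite wa uE; apply: le_trans (ps _); apply: pge => x.
rewrite /f /= sub0r (snN cr.1); have /= := qr x.
have := snB cq.1 (y + c x) y 0.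
by rewrite !subr0 opprD addrA subrr sub0r (snN cq.1); lra.
Qed.

Lemma com_right_quasi_abelian : right_quasi_abelian (COM k).
Proof.
split; first exact: (com_pre_abelian K).
move=> A B C' D a b c d po [X [f df]].
apply: (embedding_is_kernel (K := K)).
by apply: (pushout_embedding po); exact: (kernel_embedding (f := f)).
Qed.

End RightQuasiAbelian.

(** * Weighted l1 spaces and the sequence spaces derived from them *)

Section WeightedL1.
Variables (R : realType) (k : numFieldType) (K : scalars R k).

Lemma sum_uniq_sub (T : eqType) (s r : seq T) (F : T -> R) : uniq s ->
  {subset s <= r} -> (forall t, 0 <= F t) -> \sum_(t <- s) F t <= \sum_(t <- r) F t.
Proof.
move=> us sr F0; elim: s r us sr => [|a s ih] r.
  by move=> _ _; rewrite big_nil sumr_ge0.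
move=> /andP[as_ us] sr; have ar : a \in r by apply: sr; rewrite mem_head.
rewrite (perm_big _ (perm_to_rem ar)) !big_cons lerD2l; apply: ih => // t ts.
have := perm_mem (perm_to_rem ar) t; rewrite sr ?inE ?ts ?orbT//.
by have [ta|//] := eqVneq t a; rewrite -ta ts in as_.
Qed.

Section Space.
Variable T : eqType.
Local Notation fn := (T -> k^o).

(** The weighted l1 norm is at most [b], stated through finite partial sums so that an infinite norm
    needs no value. *)
Definition wbound (w : T -> R) (x : fn) (b : R) : Prop :=
  forall s, uniq s -> \sum_(t <- s) w t * mag K (x t) <= b.

(** An instance of [function_space] in which a weight stands for all its finite partial sums; [E] is
    a closed linear constraint. The constant weight 1 on nat gives l1, indicators of initial
    segments give k^N, and a one-point index set gives the scalar line. *)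
Lemma weighted_l1 (W : set (T -> R)) (E : set fn) : W !=set0 ->
  (forall w t, W w -> 0 <= w t) ->
  (forall t, exists2 w, W w & 0 < w t) ->
  (forall w w', W w -> W w' -> exists2 w'', W w'' &
    forall t, w t <= w'' t /\ w' t <= w'' t) ->
  E 0 -> (forall a x y, E x -> E y -> E (a *: x + y)) ->
  (forall x, (forall w e, W w -> 0 < e -> exists2 y, E y & wbound w (x - y) e) ->
    E x) ->
  exists (X : complete_lcs k) (i : X -> fn), [/\ linear i, injective i,
    (forall x, (E x /\ forall w, W w -> exists b, wbound w x b)
      <-> exists u, i u = x),
    (forall w, W w -> exists2 r, cs K r & forall u, wbound w (i u) (r u)) &
    forall q, cs K q -> exists w C, [/\ W w, 0 < C &
      forall u b, wbound w (i u) b -> q u <= C * b]].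
Proof.
move=> W0 w0 Wpt Wdir E0 Elin Ecl.
pose L w : set (seq (T * R)) := [set [seq (t, w t) | t <- s] | s in [set s | uniq s]].
have wsumE w s x : wsum K [seq (t, w t) | t <- s] x = \sum_(t <- s) w t * mag K (x t).
  by rewrite /wsum big_map.
have nn w s : W w -> nonneg [seq (t, w t) | t <- s].
  move=> Ww; elim: s => [|t s ih] [|j]//= hj; first exact: w0.
  exact: ih.
have LP w x b : wbound w x b <-> forall l, L w l -> wsum K l x <= b.
  split=> [h _ [s us <-]|h s us]; first by rewrite wsumE; exact: h.
  by rewrite -wsumE; apply: h; exists s.
pose S : set fn := [set x | E x /\ forall w, W w -> exists b, wbound w x b].
have [||||||||X [i [li ii iS rX csX]]] :=
  @function_space R k K T [set L w | w in W] S.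
- by have [w Ww] := W0; exists (L w), w.
- move=> _ [w Ww <-]; split; first by exists [::], [::].
  by move=> _ [s us <-]; exact: nn.
- move=> _ _ [w Ww <-] [w' Ww' <-]; have [v Wv h] := Wdir w w' Ww Ww'.
  exists (L v); first by exists v.
  move=> l [] [s us <-]; (exists [seq (t, v t) | t <- s]; first by exists s);
    move=> x; rewrite !wsumE; apply: ler_sum => t _;
    by rewrite ler_wpM2r ?mag_ge0//; have [] := h t.
- move=> t; have [w Ww wt] := Wpt t; exists (L w); first by exists w.
  by exists (w t) => //; exists [:: t].
- split=> // w Ww; exists 0 => s us; rewrite big1// => t _.
  by rewrite mag0 mulr0.
- move=> a x y [Ex bx] [Ey by_]; split; first exact: Elin.
  move=> w Ww; have [b /LP hb] := bx w Ww; have [c /LP hc] := by_ w Ww.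
  exists (mag K a * b + c); apply/LP => _ [s us <-].
  have Ls : L w [seq (t, w t) | t <- s] by exists s.
  apply: le_trans (wsumD _ _ _ (nn w s Ww)) _; rewrite wsumZ.
  by rewrite lerD ?ler_wpM2l ?mag_ge0 ?hb ?hc.
- by move=> x [_ bx] _ [w Ww <-]; have [b /LP hb] := bx w Ww; exists b.
- move=> x hx; split.
    apply: Ecl => w e Ww e0; have [|y [Ey _] hy] := hx (L w) e _ e0.
      by exists w.
    by exists y => //; apply/LP.
  move=> w Ww; have [|y [_ by_] hy] := hx (L w) 1 _ ltr01; first by exists w.
  have [b /LP hb] := by_ w Ww; exists (1 + b); apply/LP => _ [s us <-].
  have Ls : L w [seq (t, w t) | t <- s] by exists s.
  have := wsumD K (x - y) y (nn w s Ww); rewrite subrK => /le_trans; apply.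
  by rewrite lerD ?hy ?hb.
exists X, i; split=> //.
- move=> w Ww; have [|r cr hr] := rX (L w); first by exists w.
  by exists r => // u; apply/LP => l; exact: hr.
- move=> q /csX[sq [_ [C [[w Ww <-] C0 hq]]]]; exists w, C; split=> // u b /LP.
  exact: hq.
Qed.

End Space.

Lemma wbound1 (T : eqType) (x : T -> k^o) w b t : wbound w x b ->
  w t * mag K (x t) <= b.
Proof. by move=> /(_ [:: t] isT); rewrite big_cons big_nil addr0. Qed.

(** Norms with these weights are finite sums, finite on every sequence; together they generate the
    product topology of k^N. *)
Definition weight_upto (n t : nat) : R := (t <= n)%:R.

Lemma finite_wbound (T : eqType) (s0 : seq T) (w : T -> R) (x : T -> k^o) :
  (forall t, 0 <= w t) -> (forall t, t \notin s0 -> w t * mag K (x t) = 0) ->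
  wbound w x (\sum_(t <- s0) w t * mag K (x t)).
Proof.
move=> w0 h s us; rewrite (bigID (fun t => t \in s0)) /=.
rewrite [X in _ + X]big1_seq ?addr0; last by move=> t /andP[/h].
rewrite -big_filter; apply: sum_uniq_sub; first exact: filter_uniq.
  by move=> t; rewrite mem_filter => /andP[].
by move=> t; rewrite mulr_ge0 ?mag_ge0.
Qed.

Lemma all_sequences : exists (X : complete_lcs k) (i : X -> (nat -> k^o)),
  [/\ linear i, injective i, (forall x, exists u, i u = x),
    (forall n, exists2 r, cs K r & forall u, mag K (i u n) <= r u) &
    forall q, cs K q -> exists n C, 0 < C /\
      forall u b, wbound (weight_upto n) (i u) b -> q u <= C * b].
Proof.
have [|||||||X [i [li ii iS rX csX]]] :=
    @weighted_l1 nat [set weight_upto n | n in [set: nat]] setT.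
- by exists (weight_upto 0), 0%N.
- by move=> _ t [n _ <-]; exact: ler0n.
- by move=> t; exists (weight_upto t); [exists t|rewrite /weight_upto leqnn].
- move=> _ _ [n _ <-] [m _ <-]; exists (weight_upto (maxn n m)).
    by exists (maxn n m).
  move=> t; rewrite /weight_upto !ler_nat.
  by split; [case: (leqP t n)|case: (leqP t m)] => // h; rewrite leq_max h ?orbT.
- by [].
- by [].
- by [].
have nn n t : 0 <= weight_upto n t by exact: ler0n.
exists X, i; split=> //.
- move=> x; apply/iS; split=> // _ [n _ <-].
  exists (\sum_(t <- iota 0 n.+1) weight_upto n t * mag K (x t)).
  apply: finite_wbound => // t; rewrite mem_iota add0n ltnS /= /weight_upto.
  by move=> /negPf ->; rewrite mul0r.
- move=> n; have [|r cr hr] := rX (weight_upto n); first by exists n.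
  by exists r => // u; have := wbound1 n (hr u); rewrite /weight_upto leqnn mul1r.
- by move=> q /csX[_ [C [[n _ <-] C0 h]]]; exists n, C.
Qed.

Lemma summable_sequences : exists (X : complete_lcs k) (i : X -> (nat -> k^o)),
  [/\ linear i, injective i,
    (forall x, (exists b, wbound (fun=> 1) x b) <-> exists u, i u = x),
    (exists2 r, cs K r & forall u, wbound (fun=> 1) (i u) (r u)) &
    forall q, cs K q -> exists C, 0 < C /\
      forall u b, wbound (fun=> 1) (i u) b -> q u <= C * b].
Proof.
have [|||||||X [i [li ii iS rX csX]]] :=
    @weighted_l1 nat [set (fun=> 1 : R)] setT.
- by exists (fun=> 1).
- by move=> _ t ->.
- by move=> t; exists (fun=> 1).
- by move=> _ _ -> ->; exists (fun=> 1).
- by [].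
- by [].
- by [].
exists X, i; split=> //.
- move=> x; rewrite -iS; split=> [[b hb]|[_ /(_ _ erefl)]//].
  by split=> // _ ->; exists b.
- exact: rX.
- by move=> q /csX[_ [C [-> C0 h]]]; exists C.
Qed.

Lemma scalar_line : exists (X : complete_lcs k) (i : X -> k^o),
  [/\ linear i, injective i, (forall x, exists u, i u = x) &
    forall q, cs K q -> exists C, 0 < C /\
      forall u, q u <= C * mag K (i u)].
Proof.
have [|||||||X [i [li ii iS rX csX]]] :=
    @weighted_l1 unit [set (fun=> 1 : R)] setT.
- by exists (fun=> 1).
- by move=> _ t ->.
- by move=> t; exists (fun=> 1).
- by move=> _ _ -> ->; exists (fun=> 1).
- by [].
- by [].
- by [].
have bd (x : unit -> k^o) : wbound (fun=> 1) x (mag K (x tt)).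
  have := @finite_wbound unit [:: tt] (fun=> 1) x; rewrite big_seq1 mul1r; apply.
    by [].
  by case.
exists X, (fun u => i u tt); split=> //.
- by move=> a x y; rewrite li.
- by move=> x y xy; apply: ii; apply/funext => -[].
- move=> x; have [|u iu] := (iS (fun=> x)).1.
    by split=> // _ ->; exists (mag K x); exact: (bd (fun=> x)).
  by exists u; rewrite iu.
- by move=> q /csX[_ [C [-> C0 h]]]; exists C; split=> // u; apply: h; exact: bd.
Qed.

End WeightedL1.

(** * Monomorphisms are not stable under pushout *)

Section NotRightIntegral.
Variables (R : realType) (k : numFieldType) (K : scalars R k).
Local Open Scope cat_scope.

Definition unit_seq (n : nat) : nat -> k^o := fun t => (t == n)%:R.

Lemma hom_zero_uniq (Z X : COM k) (f g : hom X Z) : is_zero_object Z -> f = g.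
Proof. by move=> /(_ X)[_ [h [_ hu]]]; rewrite -(hu f) // -(hu g). Qed.

Lemma zero_hom_uniq (Z X : COM k) (f g : hom Z X) : is_zero_object Z -> f = g.
Proof. by move=> /(_ X)[[h [_ hu]] _]; rewrite -(hu f) // -(hu g). Qed.

(* The pushout of the dense injection d : l1 -> k^N, (d x)_n = x_n - x_(n+1),
   along the 0-th coordinate c : l1 -> k is 0: as c (e_0 + ... + e_n) = 1 and
   d (e_0 + ... + e_n) = e_n, maps u and v with u c = v d satisfy
   v e_n = u 1 for all n, and e_n tends to 0 in k^N. *)
Lemma com_not_right_integral : ~ right_integral (COM k).
Proof.
move=> [[[[Z Z0] _] _] stab].
have [D [iD [lD jD sD [rD cD hD] csD']]] := summable_sequences K.
have [C' [iC [lC jC sC rC csC]]] := all_sequences K.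
have [B [iB [lB jB sB csB]]] := scalar_line K.
have magD_le u t : mag K (iD u t) <= rD u.
  by have := wbound1 t (hD u); rewrite mul1r.
have /choice[c cE] : forall u, exists y, iB y = iD u 0%N by move=> u; exact: sB.
have lc : linear c by move=> a x y; apply: jB; rewrite lB !cE lD.
have [|c' c'E] := @clin_of R k K D B c lc.
  move=> q cq; have [C [C0 h]] := csB q cq.
  apply: (@cs_le R k K D _ rD C cD); first exact: (seminorm_comp lc cq.1).
  by move=> u /=; apply: le_trans (h _) _; rewrite ler_pM2l// cE.
have /choice[d dE] : forall u, exists y, iC y = (fun n => iD u n - iD u n.+1).
  by move=> u; exact: sC.
have ld : linear d.
  move=> a x y; apply: jC; rewrite lC !dE lD; apply/funext => n.
  by rewrite !fctE !scalerBr opprD addrACA.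
have [|d' d'E] := @clin_of R k K D C' d ld.
  move=> q cq; have [n [C [C0 h]]] := csC q cq.
  apply: (@cs_le R k K D _ rD (C * 2) cD); first exact: (seminorm_comp ld cq.1).
  move=> u; rewrite -mulrA; apply: h => s us; rewrite dE.
  apply: (@le_trans _ _ (\sum_(t <- s) 1 * mag K (iD u t) +
      \sum_(t <- map S s) 1 * mag K (iD u t))); last first.
    rewrite mulr2n mulrDl mul1r lerD ?hD// map_inj_uniq//; exact: succn_inj.
  rewrite big_map -big_split /=; apply: ler_sum => t _; rewrite !mul1r.
  apply: (@le_trans _ _ (mag K (iD u t - iD u t.+1))).
    by rewrite ler_piMl ?mag_ge0// /weight_upto; case: (t <= n)%N.
  by have := magD K (iD u t) (- iD u t.+1); rewrite magN.
(* A solution of d z = 0 is a constant sequence, and a nonzero constant is not summable. *)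
have dmono : is_mono (d' : @hom (COM k) D C').
  move=> X g h dgh; apply: clin_eq => x; apply/eqP; rewrite -subr_eq0; apply/eqP.
  set z := g x - h x; have dz : d z = 0.
    rewrite -d'E /z (linear_sub _ _ (clin_linear d')).
    by move/comp_eq: dgh => ->; rewrite subrr.
  have zc n : iD z n = iD z 0%N.
    elim: n => [//|n <-]; have := congr1 (fun y => y n) (dE z).
    rewrite dz (linear_at0 lC) => /esym/eqP; rewrite subr_eq0 => /eqP //.
  apply: jD; rewrite (linear_at0 lD); apply/funext => n; rewrite zc.
  apply/eqP; rewrite -(mag_eq0 K); apply/eqP/le_anti; rewrite mag_ge0 andbT.
  rewrite leNgt; apply/negP => z0.
  (* [N] is chosen so that [N] terms equal to the constant modulus exceed the l1 bound [rD z]. *)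
  have bN := archi_boundP (divr_ge0 (sn_ge0 cD.1 z) (ltW z0)).
  set N := Num.bound _ in bN.
  have := hD z (iota 0 N) (iota_uniq _ _); under eq_bigr do rewrite zc mul1r.
  rewrite big_const_seq count_predT size_iota iter_addr_0.
  by rewrite leNgt -mulr_natr mulrC -ltr_pdivrMr// bN.
pose e n : C' := sval (cid (sC (unit_seq n))).
have eE n : iC (e n) = unit_seq n by rewrite /e; case: cid.
have [one oneE] := sB 1.
have po : @is_pushout (COM k) Z B C' D (0 : clin B Z) (0 : clin C' Z) c' d'.
  split=> [|X u v uv]; first exact: hom_zero_uniq.
  have ve n : v (e n) = u one.
    have [|x xE] := (sD (fun t => (t <= n)%:R)).1.
      exists (\sum_(t <- iota 0 n.+1) 1 * mag K ((t <= n)%:R)).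
      apply: finite_wbound => [t|t]; first exact: ler01.
      by rewrite mem_iota add0n ltnS /= => /negPf ->; rewrite mag0 mulr0.
    have -> : e n = d' x.
      apply: jC; rewrite d'E dE eE xE; apply/funext => t; rewrite /unit_seq.
      by have [?|?|?] := ltngtP t n; rewrite ?subrr ?subr0.
    have -> : one = c' x by apply: jB; rewrite c'E cE xE oneE.
    by move/comp_eq: uv => ->.
  (* A continuous seminorm composed with [v] sees only finitely many coordinates of k^N, so a value
     attained on sequences vanishing on arbitrarily long initial segments is 0. *)
  have small y : (forall m, exists2 y', v y' = v y &
      forall t, (t <= m)%N -> iC y' t = 0) -> v y = 0.
    move=> hy; apply: (@lcs_separated R k K X) => r cr.
    have [m [C [C0 h]]] := csC _ (clin_cs v cr); have [y' <- y'0] := hy m.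
    apply/eqP; rewrite eq_le (sn_ge0 cr.1) andbT -(mulr0 C); apply: h => q _.
    rewrite big1// => t _; rewrite /weight_upto; case: leqP => tm.
      by rewrite y'0// mag0 mulr0.
    by rewrite mul0r.
  have u1 : u one = 0.
    rewrite -(ve 0%N); apply: small => m; exists (e m.+1); first by rewrite !ve.
    by move=> t tm; rewrite eE /unit_seq ltn_eqF.
  have u0 : u = 0.
    apply: clin_eq => y; have -> : y = iB y *: one.
      apply: jB; rewrite (linear_scale _ _ lB) oneE.
      by rewrite -[RHS]/(iB y * 1) mulr1.
    by rewrite (linear_scale _ _ (clin_linear u)) u1 scaler0.
  have v0 : v = 0.
    apply: clin_eq => y; apply: small => m.
    (* Truncations of [y] are combinations of the [e n], which [v] kills; subtracting them leaves
       [v y] unchanged and clears the first coordinates. *)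
    have tr n : exists2 y', v y' = 0 &
        forall t, iC y' t = if (t < n)%N then iC y t else 0.
      elim: n => [|n [y' vy' ty']].
        by exists 0; [exact: (linear_at0 (clin_linear v))|rewrite (linear_at0 lC)].
      exists (iC y n *: e n + y').
        by rewrite (clin_linear v) vy' ve u1 scaler0 addr0.
      move=> t; rewrite lC -[LHS]/(iC y n * iC (e n) t + iC y' t) ty' eE /unit_seq.
      rewrite ltnS (leq_eqVlt t n); have [->|_] := eqVneq t n.
        by rewrite ltnn /= mulr1 addr0.
      by rewrite mulr0 add0r.
    have [y' vy' ty'] := tr m.+1; exists (y - y').
      by rewrite (linear_sub _ _ (clin_linear v)) vy' subr0.
    move=> t tm; rewrite (linear_sub _ _ lC) -[LHS]/(iC y t - iC y' t) ty'.
    by rewrite ltnS tm subrr.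
  exists 0; split.
    by rewrite u0 v0; split; apply/comp_eq0.
  by move=> w _; exact: zero_hom_uniq.
(* Stability would make the zero map from [B] to [Z] a monomorphism, so the identity of [B] would be
   0. *)
have amono := stab Z B C' D _ _ _ _ po dmono.
have idB0 := amono B (idm (B : COM k)) 0 (hom_zero_uniq _ _ Z0).
have : one = 0 by exact: (congr1 (fun h : clin B B => h one) idB0).
by move/(congr1 iB); rewrite oneE (linear_at0 lB) => /eqP; rewrite oner_eq0.
Qed.

End NotRightIntegral.

(** * A morphism that is not a cokernel followed by a monomorphism *)

Section NotLeftSemiAbelian.
Variables (R : realType) (k : numFieldType) (K : scalars R k).
Local Open Scope cat_scope.

Definition half (n : nat) : R := 2^-1 ^+ n.

Lemma half_gt0 n : 0 < half n.
Proof. by rewrite exprn_gt0// invr_gt0. Qed.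

Lemma halfS n : half n = 2 * half n.+1.
Proof. by rewrite /half exprS mulrA divff ?mul1r// pnatr_eq0. Qed.

Lemma half_small (e : R) : 0 < e -> exists n, half n < e.
Proof.
move=> e0; have ie : 0 <= e^-1 by rewrite invr_ge0 ltW.
exists (Num.bound e^-1); have := archi_boundP ie; set n := Num.bound _ => en.
rewrite /half exprVn -[ltRHS]invrK ltf_pV2 ?posrE ?invr_gt0 ?exprn_gt0//.
by apply: lt_trans en _; rewrite -natrX ltr_nat ltn_expl.
Qed.

(** Boundedness of [z] for each continuous seminorm makes the partial sums Cauchy, by comparison
    with the geometric series. *)
Lemma geometric_series (I : complete_lcs k) (z : nat -> I) :
  (forall r, cs K r -> exists C, forall n, r (z n) <= C) ->
  exists l, forall r, cs K r -> forall e, 0 < e -> exists N, forall n, (N <= n)%N ->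
    r (\sum_(t < n) emb K (half t) *: z t - l) < e.
Proof.
move=> bz; pose s n := \sum_(t < n) emb K (half t) *: z t.
pose F : set_system I := [set Q | exists N, forall n, (N <= n)%N -> Q (s n)].
have FF : ProperFilter F.
  split; first by move=> [N /(_ N (leqnn N))].
  split.
  - by exists 0%N.
  - move=> P Q [N hN] [M hM]; exists (maxn N M) => n; rewrite geq_max => /andP[h1 h2].
    by split; [exact: hN|exact: hM].
  - by move=> P Q PQ [N hN]; exists N => n /hN /PQ.
have [|l Fl] := @lcs_cauchy_lim R k K I F FF; last by exists l.
move=> r cr e e0; have [C hC] := bz r cr.
have C0 : 0 <= C by rewrite (le_trans _ (hC 0%N))// (sn_ge0 cr.1).
(* An increment is at most C 2^-(N+m), which equals 2 C ([half (N + m)] - [half (N + m).+1]), so the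
   bound telescopes. *)
have step N m : r (s (N + m)%N - s N) <= 2 * C * (half N - half (N + m)).
  elim: m => [|m ih]; first by rewrite addn0 !subrr (sn0 cr.1) mulr0.
  have := snB cr.1 (s (N + m)%N) (s (N + m.+1)%N) (s N) => /le_trans; apply.
  rewrite addnS /s big_ord_recr /= addrAC subrr add0r -/(s _) -/(s _).
  rewrite (snZ cr.1) mag_emb gtr0_norm ?half_gt0//.
  have := hC (N + m)%N; rewrite -(ler_pM2l (half_gt0 (N + m))).
  by move: ih; rewrite (halfS (N + m)); lra.
have M0 : 0 < 2 * C + 1 by rewrite ltr_wpDl// mulr_ge0.
have [N hN] := half_small (divr_gt0 e0 M0).
exists (s N), N => n Nn; rewrite /= -(subnKC Nn).
apply: le_lt_trans (step _ _) _.
rewrite ltr_pdivlMr// in hN; apply: le_lt_trans _ hN.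
have h1 := half_gt0 (N + (n - N)); have h2 := half_gt0 N.
have h3 : 0 <= C * half (N + (n - N)) by rewrite mulr_ge0// ltW.
by move: h1 h2 h3; lra.
Qed.

(** Two demands are balanced. Finitely many entries of each row may be weighted arbitrarily heavily,
    which leaves only finitely many nonzero rows; yet weights are eventually 1 along each row, so
    that every unit sequence has a preimage of norm 2 for any given weight. *)
Definition row_weights : set (nat * nat -> R) := [set w |
  [/\ forall t, 1 <= w t, forall n, w (n, 0%N) = 1 &
      forall n, exists M, forall m, (M <= m)%N -> w (n, m) = 1]].

(** Column 0 records the value of the map to l1, while the mass that produces it may sit arbitrarily
    far out in the row. *)
Definition row_sums : set (nat * nat -> k^o) := [set x | forall n e, 0 < e ->
  exists M0, forall M, (M0 <= M)%N ->
    mag K (x (n, 0%N) - \sum_(m < M) x (n, m.+1)) < e].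

(* Every row of an element of [row_space] is summable, with sum its 0-th entry,
   but only finitely many rows are nonzero because the weights grow freely
   along the rows. *)
Lemma row_space : exists (A : complete_lcs k) (i : A -> (nat * nat -> k^o)),
  [/\ linear i, injective i,
    (forall x, (row_sums x /\ forall w, row_weights w -> exists b, wbound K w x b)
      <-> exists u, i u = x),
    (forall w, row_weights w -> exists2 r, cs K r & forall u, wbound K w (i u) (r u)) &
    forall q, cs K q -> exists w C, [/\ row_weights w, 0 < C &
      forall u b, wbound K w (i u) b -> q u <= C * b]].
Proof.
have w1 : row_weights (fun=> 1) by split=> // n; exists 0%N.
apply: weighted_l1.
- by exists (fun=> 1).
- by move=> w t [/(_ t) w_ge1 _ _]; apply: le_trans w_ge1.
- by move=> t; exists (fun=> 1).
- move=> w w' [a1 a2 a3] [b1 b2 b3]; exists (fun t => Num.max (w t) (w' t)).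
    split=> [t|n|n]; first by rewrite le_max a1.
      by rewrite a2 b2 maxxx.
    have [M hM] := a3 n; have [N hN] := b3 n; exists (maxn M N) => m.
    by rewrite geq_max => /andP[h1 h2]; rewrite hM// hN// maxxx.
  by move=> t; rewrite !le_max !lexx orbT.
- by move=> n e e0; exists 0%N => M _; rewrite big1// subrr mag0.
- move=> a x y Ex Ey n e e0.
  have M0 : 0 < mag K a + 1 by rewrite ltr_wpDl ?mag_ge0.
  have e2 : 0 < e / 2 by rewrite divr_gt0.
  have [M hM] := Ex n _ (divr_gt0 e2 M0); have [N hN] := Ey n _ e2.
  exists (maxn M N) => m; rewrite geq_max => /andP[/hM h1 /hN h2].
  have -> : (a *: x + y) (n, 0%N) - \sum_(j < m) (a *: x + y) (n, j.+1) =
      a * (x (n, 0%N) - \sum_(j < m) x (n, j.+1)) +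
      (y (n, 0%N) - \sum_(j < m) y (n, j.+1)).
    by rewrite !fctE big_split /= mulrBr mulr_sumr opprD addrACA.
  apply: le_lt_trans (magD _ _ _) _; rewrite magM.
  suff : mag K a * mag K (x (n, 0%N) - \sum_(j < m) x (n, j.+1)) <= e / 2.
    by move: h2; lra.
  apply: (@le_trans _ _ ((mag K a + 1) *
      mag K (x (n, 0%N) - \sum_(j < m) x (n, j.+1)))).
    by rewrite ler_wpM2r ?mag_ge0// lerDl.
  by rewrite -ler_pdivlMl// mulrC ltW.
- move=> x clx n e e0; have e2 : 0 < e / 2 by rewrite divr_gt0.
  have [y Ey hy] := clx _ _ w1 e2; have [M hM] := Ey n _ e2; exists M => m /hM h.
  have -> : x (n, 0%N) - \sum_(j < m) x (n, j.+1) =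
      (y (n, 0%N) - \sum_(j < m) y (n, j.+1)) +
      ((x - y) (n, 0%N) - \sum_(j < m) (x - y) (n, j.+1)).
    rewrite !fctE sumrB opprB [RHS]addrACA; congr (_ + _).
      by rewrite addrC subrK.
    by rewrite addrA addNr add0r.
  apply: le_lt_trans (magD _ _ _) _.
  (* The row-sum defect of [x - y] is bounded by its l1 mass on [s], which is why the constraint is
     closed. *)
  pose s := (n, 0%N) :: [seq (n, j.+1) | j <- iota 0 m].
  have us : uniq s.
    rewrite /= map_inj_uniq ?iota_uniq ?andbT; last by move=> i j [].
    by apply/negP => /mapP[].
  have := hy s us; rewrite big_cons big_map mul1r => hs.
  have := magD K ((x - y) (n, 0%N)) (- \sum_(j < m) (x - y) (n, j.+1)).
  rewrite magN.
  have := mag_sum K (index_enum 'I_m) (fun j => (x - y) (n, j.+1)).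
  move: hs; under eq_bigr do rewrite mul1r.
  rewrite -(big_mkord xpredT (fun j => mag K ((x - y) (n, j.+1)))).
  rewrite /index_iota subn0.
  by move: h; lra.
Qed.

(** If infinitely many rows had a nonzero entry beyond column 0, weighting one such entry per row by
    at least its inverse modulus would be admissible and give an infinite norm. A row without such
    an entry has 0-th entry 0 by [row_sums]. *)
Lemma finitely_many_rows (x : nat * nat -> k^o) : row_sums x ->
  (forall w, row_weights w -> exists b, wbound K w x b) ->
  exists N, forall n, (N <= n)%N -> x (n, 0%N) = 0.
Proof.
move=> xs xb; pose bad n := exists m, x (n, m.+1) != 0.
suff [N hN] : exists N, forall n, (N <= n)%N -> ~ bad n.
  exists N => n /hN nb; apply/eqP; rewrite -(mag_eq0 K); apply/eqP/le_anti.
  rewrite mag_ge0 andbT; apply/ler_addgt0Pl => e e0; rewrite addr0.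
  have [M /(_ M (leqnn M))] := xs n e e0; rewrite big1 ?subr0; first exact: ltW.
  move=> j _; apply/eqP; apply/negP => /negP h; apply: nb.
  by exists j.
apply: contrapT => /forallNP many.
have badge N : exists n, (N <= n)%N /\ bad n.
  have /existsNP[n /not_implyP[Nn /contrapT bn]] := many N.
  by exists n.
pose pick n := if pselect (bad n) is left h then sval (cid h) else 0%N.
have pickP n : bad n -> x (n, (pick n).+1) != 0.
  by rewrite /pick; case: pselect => // h _; case: cid.
pose w (t : nat * nat) : R := if (t.2 == (pick t.1).+1) then
  Num.max 1 (mag K (x t))^-1 else 1.
have Ww : row_weights w.
  split=> [t|n|n].
  - by rewrite /w; case: ifP => _ //; rewrite le_max lexx.
  - by rewrite /w.
  - exists (pick n).+2 => m hm; rewrite /w /= gtn_eqF//.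
have [b hb] := xb w Ww.
have w1 n : bad n -> 1 <= w (n, (pick n).+1) * mag K (x (n, (pick n).+1)).
  move=> /pickP xn; have m0 : 0 < mag K (x (n, (pick n).+1)) by rewrite mag_gt0.
  by rewrite -ler_pdivrMr// div1r /w /= eqxx le_max lexx orbT.
have lists j : exists s : seq nat, [/\ uniq s, size s = j & forall n, n \in s -> bad n].
  elim: j => [|j [s [us sz sb]]]; first by exists [::].
  have [n [sn bn]] := badge (\max_(i <- s) i).+1.
  exists (n :: s); split=> /=; last by move=> i; rewrite inE => /predU1P[->//|/sb].
    rewrite us andbT; apply/negP => ns; move: sn.
    by rewrite ltnNge (leq_bigmax_seq (P := xpredT) (F := id)).
  by rewrite sz.
have [s [us sz sb]] := lists (Num.bound `|b|).
have us' : uniq [seq (n, (pick n).+1) | n <- s].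
  by rewrite map_inj_uniq// => i j [].
have := hb _ us'; rewrite big_map leNgt => /negP; apply.
apply: (@lt_le_trans _ _ (Num.bound `|b|)%:R).
  by apply: le_lt_trans (ler_norm b) _; rewrite archi_boundP.
rewrite -sz -sum1_size natr_sum big_seq [leRHS]big_seq; apply: ler_sum => n /sb.
exact: w1.
Qed.

(* Suppose Pi T = i p, where T : A -> l1 takes the 0-th column of the row space
   A and (Pi y)_n = y_(n+1) - y_n / 2. As T x has finite support, Pi T and T
   have the same kernel, so T = h p. The map T is open onto its image, so for
   x_N with T x_N = (1, 1/2, ..., 2^-(N-1), 0, ...) the sequence p x_N has a
   limit l. Then i l = 0, hence l = 0, although (h l)_0 = 1. *)
Lemma com_not_left_semi_abelian : ~ left_semi_abelian (COM k).
Proof.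
move=> [_ fact].
have [A [iA [lA jA sA rA csA]]] := row_space.
have [L [iL [lL jL sL [rL cL hL] csL]]] := summable_sequences K.
have [N [iN [lN jN sN rN csN]]] := all_sequences K.
have w1 : row_weights (fun=> 1) by split=> // n; exists 0%N.
have [r1 cr1 hr1] := rA _ w1.
have bT u : wbound K (fun=> 1) (fun n => iA u (n, 0%N)) (r1 u).
  move=> s us; have us' : uniq [seq (n, 0%N) | n <- s].
    by rewrite map_inj_uniq// => i j [].
  by have := hr1 u _ us'; rewrite big_map.
have /choice[T0 T0E] : forall u, exists y, iL y = fun n => iA u (n, 0%N).
  by move=> u; apply/sL; exists (r1 u).
have lT0 : linear T0 by move=> a x y; apply: jL; rewrite lL !T0E lA.
have [|T TE'] := @clin_of R k K A L T0 lT0.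
  move=> q cq; have [C [C0 h]] := csL q cq.
  apply: (@cs_le R k K A _ r1 C cr1); first exact: (seminorm_comp lT0 cq.1).
  by move=> u /=; apply: h; rewrite T0E.
have TE u n : iL (T u) n = iA u (n, 0%N) by rewrite TE' T0E.
pose c2 := emb K 2^-1.
have c20 : c2 != 0 by rewrite emb_eq0 invr_eq0 pnatr_eq0.
have /choice[P0 P0E] : forall u, exists y, iN y = fun n => iL u n.+1 - iL u n * c2.
  by move=> u; exact: sN.
have lP0 : linear P0.
  have alg (a b b' d d' : k) :
      (a * b + b') - (a * d + d') * c2 = a * (b - d * c2) + (b' - d' * c2) by ring.
  by move=> a x y; apply: jN; rewrite lN !P0E lL; apply/funext => n; exact: alg.
have [|Pi PiE'] := @clin_of R k K L N P0 lP0.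
  move=> q cq; have [n [C [C0 h]]] := csN q cq.
  apply: (@cs_le R k K L _ rL (C * 2) cL); first exact: (seminorm_comp lP0 cq.1).
  move=> u; rewrite -mulrA; apply: h => s us; rewrite P0E.
  apply: (@le_trans _ _ (\sum_(t <- map S s) 1 * mag K (iL u t) +
      \sum_(t <- s) 1 * mag K (iL u t))); last first.
    by rewrite mulr2n mulrDl mul1r lerD ?hL// map_inj_uniq//; exact: succn_inj.
  rewrite big_map -big_split /=; apply: ler_sum => t _; rewrite !mul1r.
  apply: (@le_trans _ _ (mag K (iL u t.+1 - iL u t * c2))).
    by rewrite ler_piMl ?mag_ge0// /weight_upto; case: (t <= n)%N.
  apply: le_trans (magD _ _ _) _; rewrite magN magM lerD2l ler_piMr ?mag_ge0//.
  by rewrite mag_emb gtr0_norm; lra.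
have PiE u n : iN (Pi u) n = iL u n.+1 - iL u n * c2 by rewrite PiE' P0E.
have [I [p [i [fip mono_i [G [g [pg univ]]]]]]] :=
  fact A N ((Pi : @hom (COM k) L N) \oc (T : @hom (COM k) A L)).
have fE u : Pi (T u) = i (p u).
  exact: (congr1 (fun h : clin A N => h u) fip).
(* A monomorphism is injective here: it sends both its kernel inclusion and the zero map to 0. *)
have i_inj z : i z = 0 -> z = 0.
  have [X [j [_ ji]]] := kernel_ex K i; move=> /ji[u <-].
  have j0 : j = 0.
    apply: mono_i; apply/comp_eq => v.
    have -> : i (j v) = 0 by apply/ji; exists v.
    exact/esym/(linear_at0 (clin_linear i)).
  by rewrite j0.
have kerT u : p u = 0 -> T u = 0.
  move=> pu; have fu : Pi (T u) = 0.
    by rewrite fE pu (linear_at0 (clin_linear i)).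
  have [xs xb] : row_sums (iA u) /\ forall w, row_weights w ->
      exists b, wbound K w (iA u) b by apply/sA; exists u.
  have [M hM] := finitely_many_rows xs xb.
  apply: jL; rewrite (linear_at0 lL); apply/funext => n.
  (* Downward induction from beyond the support: as Pi (T u) = 0, each entry of T u is half the
     preceding one, so a zero at m + 1 forces a zero at m. *)
  have H j m : (M <= m + j)%N -> iL (T u) m = 0.
    elim: j m => [|j ih] m; first by rewrite addn0 TE; exact: hM.
    rewrite addnS -addSn => /ih ym.
    have := PiE (T u) m; rewrite fu (linear_at0 lN) ym sub0r => /esym/eqP.
    by rewrite oppr_eq0 mulf_eq0 (negPf c20) orbF => /eqP.
  by apply: (H M); rewrite leq_addl.
(* [p] is a cokernel of [g], and [kerT] turns p g = 0 into T g = 0. *)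
have [h [/comp_eq hp _]] : exists! h : @hom (COM k) I L, h \oc p = T.
  by apply: univ; apply/comp_eq0 => x; apply: kerT; move/comp_eq0: pg; exact.
(* A preimage of the n-th unit sequence with its mass in column M + 1; [M] stays free until a weight
   is given. *)
pose delta n M : nat * nat -> k^o := fun t =>
  ((t.1 == n) && ((t.2 == 0%N) || (t.2 == M.+1)))%:R.
have row_elt n M : exists u, iA u = delta n M.
  apply/sA; split=> [n' e e0|w Ww].
    exists M.+1 => M' MM'; rewrite /delta (bigD1 (Ordinal MM'))//= eqxx ?orbT ?andbT.
    rewrite big1 ?addr0 ?subrr ?mag0// => m /eqP mM.
    rewrite [_.+1 == M.+1](_ : _ = false) ?andbF//; apply/eqP => -[mE].
    by apply: mM; exact: val_inj.
  have w0 t : 0 <= w t by have [/(_ t) + _ _] := Ww; apply: le_trans.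
  exists (\sum_(t <- [:: (n, 0%N); (n, M.+1)]) w t *
    mag K (((t.1 == n) && ((t.2 == 0%N) || (t.2 == M.+1)))%:R)).
  apply: finite_wbound => // -[a b]; rewrite !inE !xpair_eqE /= -andb_orr.
  by move=> /negPf h0; rewrite /delta /= h0 mag0 mulr0.
pose e n M := sval (cid (row_elt n M)).
have eE n M : iA (e n M) = delta n M by rewrite /e; case: cid.
have eE0 n M m : iA (e n M) (m, 0%N) = (m == n)%:R by rewrite eE /delta /= andbT.
(* [T] does not see [M], so neither does i p; injectivity of [i] removes it from [p]. *)
have pe n M : p (e n M) = p (e n 0%N).
  apply/eqP; rewrite -subr_eq0; apply/eqP/i_inj.
  rewrite (linear_sub _ _ (clin_linear i)) -!fE.
  suff -> : T (e n M) = T (e n 0%N) by rewrite subrr.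
  by apply: jL; apply/funext => m; rewrite !TE !eE0.
(* The weight [w] is fixed by [r] first; [M] is then taken so far out in row [n] that both nonzero
   entries have weight 1, and the norm is 2 whatever [n] is. *)
have bz r : cs K r -> exists C, forall n, r (p (e n 0%N)) <= C.
  move=> cr; have [w [C [Ww C0 hC]]] := csA _ (clin_cs p cr).
  exists (C * 2) => n; have [w_ge1 wn0 /(_ n)[M hM]] := Ww.
  rewrite -(pe n M); apply: hC.
  have w0 t : 0 <= w t by exact: le_trans (w_ge1 t).
  have := @finite_wbound R k K _ [:: (n, 0%N); (n, M.+1)] w (iA (e n M)) w0.
  rewrite !big_cons big_nil eE /delta /= !eqxx /= ?orbT wn0 hM// mag1 !mul1r addr0.
  rewrite -[1 + 1]/2; apply => -[a b].
  rewrite !inE !xpair_eqE /= -andb_orr => /negPf ->.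
  by rewrite mag0 mulr0.
have [l hl] := geometric_series bz.
have partial n : exists2 u, p u = \sum_(t < n) emb K (half t) *: p (e t 0%N) &
    forall m, iA u (m, 0%N) = if (m < n)%N then emb K (half m) else 0.
  elim: n => [|n [u pu uE]].
    exists 0; first by rewrite big_ord0; exact: (linear_at0 (clin_linear p)).
    by move=> m; rewrite (linear_at0 lA).
  exists (emb K (half n) *: e n 0%N + u).
    by rewrite (clin_linear p) pu big_ord_recr /= addrC.
  move=> m; rewrite lA -[LHS]/(emb K (half n) * iA (e n 0%N) (m, 0%N) + iA u (m, 0%N)).
  rewrite eE0 uE ltnS (leq_eqVlt m n); have [->|_] := eqVneq m n.
    by rewrite ltnn mulr1 addr0.
  by rewrite mulr0 add0r.
(* With at least n + 2 terms, coordinate [n] of Pi (T u) is 2^-(n+1) - 2^-n / 2 = 0, so coordinate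
   [n] of i l is a limit of zeros. *)
have l0 : l = 0.
  apply: i_inj; apply: jN; rewrite (linear_at0 lN); apply/funext => n.
  have [r cr hr] := rN n; apply/eqP; rewrite -(mag_eq0 K); apply/eqP/le_anti.
  rewrite mag_ge0 andbT; apply/ler_addgt0Pl => d d0; rewrite addr0.
  have [M hM] := hl _ (clin_cs i cr) d d0.
  have [u pu uE] := partial (maxn M n.+2).
  have := hM _ (leq_maxl M n.+2); rewrite -pu /=.
  rewrite (linear_sub _ _ (clin_linear i)) -fE => /ltW; apply: le_trans.
  apply: le_trans (hr _); rewrite (linear_sub _ _ lN).
  rewrite -[X in _ <= mag K X]/(iN (Pi (T u)) n - iN (i l) n) PiE !TE !uE.
  rewrite !leq_max !ltnS !leqnn leqnSn !orbT (halfS n) /c2 -rmorphM.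
  by rewrite mulrAC divff ?mul1r ?pnatr_eq0// subrr sub0r magN.
(* As [l] is 0, the l1 bound of h (p u) = T u drops below 1, although the 0-th entry of T u is 1. *)
have [M hM] := hl _ (clin_cs h cL) 1 ltr01.
have [u pu uE] := partial M.+1.
have := hM _ (leqnSn M); rewrite -pu l0 subr0 /= hp.
apply/negP; rewrite -leNgt; have := wbound1 0%N (hL (T u)).
by rewrite TE uE ltnS leq0n mul1r /half expr0 rmorph1 mag1.
Qed.

End NotLeftSemiAbelian.

Theorem theorem3p3 (R : realType) (k : numFieldType)
    (hk : k = (R : numFieldType) \/ k = (complex R : numFieldType)) :
  right_quasi_abelian (COM k) /\
  ~ left_semi_abelian (COM k) /\
  ~ right_integral (COM k).
Proof.
suff main : scalars R k -> right_quasi_abelian (COM k) /\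
    ~ left_semi_abelian (COM k) /\ ~ right_integral (COM k).
  by case: hk => e; apply: main; rewrite e;
    [exact: real_scalars|exact: complex_scalars].
move=> K; split; first exact: com_right_quasi_abelian K.
by split; [exact: com_not_left_semi_abelian K|exact: com_not_right_integral K].
Qed.
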